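(* Let $K$ be an algebraically closed field of arbitrary characteristic. For all $n\geq 2$, the dimension of the set ${\mathcal A}_n$ of $K$-automorphisms of $K[x,y]$ of degree $\leq n$ is equal to $n+6$.
   Context: A $K$-endomorphism $\varphi$ of $K[x,y]$ is written $\varphi=(f,g)$, where $f=\varphi(x)$ and $g=\varphi(y)$. Its degree is $\deg(\varphi)=\max\{\deg(f),\deg(g)\}$, where $\deg$ denotes the total degree. The endomorphisms of degree $\leq n$ are identified with the points of the affine space $K^N$, $N=(n+1)(n+2)$, whose coordinates are the coefficients of $f$ and $g$ at the monomials of degree $\leq n$. $K^N$ carries the Zariski topology, and the dimension of a subset is the dimension of its Zariski closure. *)

(* Defs.v *)
From HB Require Import structures.
From mathcomp Require Import all_boot all_order all_algebra.
From mathcomp Require Import boolp classical_sets.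
From mathcomp Require Import mpoly.

Set Implicit Arguments.
Unset Strict Implicit.
Unset Printing Implicit Defensive.

Import GRing.Theory.
Local Open Scope ring_scope.
Local Open Scope classical_set_scope.

Section Zariski.
Variables (K : closedFieldType) (N : nat).
Implicit Types (A X Z : set 'rV[K]_N) (S : set {mpoly K[N]}).

Definition zero_locus S : set 'rV[K]_N :=
  [set v | forall p, S p -> p.@[v ord0] = 0].

Definition zariski_closed Z : Prop := exists S, Z = zero_locus S.

Definition zariski_closure A : set 'rV[K]_N := smallest zariski_closed A.

Definition zariski_irreducible Z : Prop :=
  Z !=set0 /\
  forall Z1 Z2, zariski_closed Z1 -> zariski_closed Z2 ->
    Z `<=` Z1 `|` Z2 -> Z `<=` Z1 \/ Z `<=` Z2.

(* A strict chain C 0 < ... < C d of irreducible closed subsets of X.  When X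
   is closed, the subsets of X that are closed in X for the subspace topology
   are exactly the closed subsets of the affine space contained in X. *)
Definition irreducible_chain X (d : nat) (C : nat -> set 'rV[K]_N) : Prop :=
  (forall i, (i <= d)%N ->
     [/\ zariski_closed (C i), zariski_irreducible (C i) & C i `<=` X]) /\
  (forall i, (i < d)%N -> C i `<` C i.+1).

(* d is the Krull dimension of the closed set X; the empty set has none. *)
Definition krull_dim_is X (d : nat) : Prop :=
  (exists C, irreducible_chain X d C) /\
  (forall e C, irreducible_chain X e C -> (e <= d)%N).

Definition zariski_dim_is A (d : nat) : Prop :=
  krull_dim_is (zariski_closure A) d.

End Zariski.

Section CoefficientIndex.
Variable n : nat.

(* Indices of the coordinates: (i, m) stands for the coefficient at the monomial
   m, of degree at most n, of the image of the i-th variable. *)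
Definition coef_index : finType := ('I_2 * 'X_{1..2 < n.+1})%type.

Lemma card_bmnm2 : #|{: 'X_{1..2 < n.+1}}| = 'C(n.+2, 2).
Proof.
rewrite -[n.+2]/(2 + n)%N -card_partial_ord_partitions.
pose h (m : 'X_{1..2 < n.+1}) : 2.-tuple 'I_n.+1 :=
  [tuple inord ((m : 'X_{1..2}) i) | i < 2].
have hE m i : tnth (h m) i = (m : 'X_{1..2}) i :> nat.
  rewrite tnth_mktuple inordK //; apply: leq_ltn_trans (bmdeg m).
  by rewrite mdegE (bigD1 i) //= leq_addr.
have h_inj : injective h.
  move=> m1 m2 eqh; apply/val_inj/mnmP => i.
  by rewrite -!hE eqh.
rewrite -(card_imset _ h_inj); apply: eq_card => t; rewrite inE.
rewrite big_tuple; apply/imsetP/idP => [[m _ ->]|tn].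
  under eq_bigr do rewrite hE.
  by rewrite -mdegE -ltnS; exact: bmdeg.
have dm : (mdeg [multinom (tnth t i : nat) | i < 2] < n.+1)%N.
  by rewrite mdegE ltnS; under eq_bigr do rewrite mnmE.
exists (BMultinom dm) => //; apply: eq_from_tnth => i.
by apply/val_inj; rewrite /= hE /= mnmE.
Qed.

Lemma card_coef_index : #|coef_index| = (n.+1 * n.+2)%N.
Proof.
by rewrite card_prod card_ord card_bmnm2 -mul_bin_diag bin1 mulnC.
Qed.

Definition coef_of_ord (k : 'I_(n.+1 * n.+2)) : coef_index :=
  enum_val (cast_ord (esym card_coef_index) k).

End CoefficientIndex.

Section Automorphisms.
Variable K : closedFieldType.

(* Total degree, with the convention that the zero polynomial has degree 0. *)
Definition total_deg (p : {mpoly K[2]}) : nat := (msize p).-1.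

Definition endo : Type := {lrmorphism {mpoly K[2]} -> {mpoly K[2]}}.

Definition endo_deg (phi : endo) : nat :=
  maxn (total_deg (phi 'X_0)) (total_deg (phi 'X_1)).

(* Determines phi as soon as endo_deg phi <= n. *)
Definition endo_point (n : nat) (phi : endo) : 'rV[K]_(n.+1 * n.+2) :=
  \row_k (phi 'X_((coef_of_ord k).1))@_((coef_of_ord k).2).

Definition aut_le (n : nat) : set 'rV[K]_(n.+1 * n.+2) :=
  [set endo_point n phi | phi in
     [set phi : endo | bijective phi /\ (endo_deg phi <= n)%N]].

End Automorphisms.

Arguments aut_le : clear implicits.

(* Main.v *)
(* Upper bound. If f is the image of a variable under an automorphism, a nontrivial
   polynomial family of endomorphisms (translation of the second image) fixes f,
   and for positive weights its initial form is a nontrivial family fixing the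
   leading form of f. Fixed polynomials have fixed factors, so the leading form is
   a power of a single irreducible factor, and a derivation argument, valid in all
   characteristics, excludes the factors y^p - z x^q with p, q >= 2. Hence a
   triangular substitution lowers the degree of f. Iterating, f of degree k splits
   off triangular maps of degrees m_1, m_2, and so on with product k, and the second
   image is, up to smaller degree, a polynomial of degree q in f, with q k <= n.
   Counting parameters, the automorphisms of degree <= n lie in finitely many
   polynomial images of affine spaces of dimension <= n + 6. A chain of irreducible
   closed sets of length e in the closure of such an image gives e algebraically
   independent polynomials in the parameters, so e <= n + 6.

   Lower bound. The maps a l + b (y + P(l)) + c, a' l + b' (y + P(l)) + c' with
   l = x + la y and P with terms of degree 2 up to n depend on n + 6 parameters;
   freeing these one at a time, in a suitable order, gives a chain of closures of
   images, each step being detected by a single coefficient. *)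
Require Import Defs.
From mathcomp Require Import all_boot all_order all_algebra.
From HB Require Import structures.
From mathcomp Require Import boolp classical_sets mpoly zify ring.

Set Implicit Arguments.
Unset Strict Implicit.
Unset Printing Implicit Defensive.

Import GRing.Theory.
Local Open Scope ring_scope.

(** * Substitutions in two variables *)

(** In characteristic p every derivation kills all p-th powers, so invariance of f under a
    derivation says too little. It is replaced by a polynomial family (X(t), Y(t)), equal to the
    identity at t = 0, with f(X, Y) = f in K[x,y][t]. Members of the family need not be
    automorphisms and no group law in t is asked for, so that initial forms of families are again
    families of the same kind.

    Only f is reduced. Once f is linear, the second image is known up to a polynomial Q(f) and a
    linear term; Q stays on the target side through all source substitutions, which is why its
    degree q multiplies k.

    Origin of n + 6: six coefficients of an affine map, n - 1 coefficients of a triangular map in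
    degrees 2 to n, and one parameter for the linear form whose power is the leading form. Splitting
    the degree into several factors never costs more, since a sum of integers at least 2 is bounded
    by their product. *)

Lemma ord2_cases (i : 'I_2) : i = 0 \/ i = 1.
Proof. by case: i => [[|[|i]] ip] //; [left | right]; apply: val_inj. Qed.

Lemma big_ord2 (T : Type) (idx : T) (op : Monoid.law idx) (F : 'I_2 -> T) :
  \big[op/idx]_(i < 2) F i = op (F 0) (F 1).
Proof.
rewrite !big_ord_recl big_ord0 Monoid.mulm1.
by congr (op (F _) (F _)); apply: val_inj.
Qed.

(** Evaluation through a coefficient morphism [h]: the same construction serves for substitution in
    K[x,y], for families over K[x,y][t] and for restriction to lines. *)
HB.lock Definition bieval (K : fieldType) (S : comNzRingType)
    (h : {rmorphism K -> S}) (a b : S) (p : {mpoly K[2]}) : S :=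
  mmap h (fun i : 'I_2 => if i == 0 then a else b) p.

Lemma bieval_mmap (K : fieldType) (S : comNzRingType) (h : {rmorphism K -> S}) (a b : S) :
  bieval h a b = mmap h (fun i : 'I_2 => if i == 0 then a else b).
Proof. by rewrite unlock. Qed.

Section Bieval.
Variables (K : fieldType) (S : comNzRingType) (h : {rmorphism K -> S}) (a b : S).

Let bieval_is_zmod : zmod_morphism (bieval h a b).
Proof. by rewrite bieval_mmap; exact: raddfB. Qed.

Let bieval_is_monoid : monoid_morphism (bieval h a b).
Proof. by rewrite bieval_mmap; split; [exact: rmorph1 | exact: rmorphM]. Qed.

HB.instance Definition _ := GRing.isZmodMorphism.Build _ _ (bieval h a b) bieval_is_zmod.
HB.instance Definition _ := GRing.isMonoidMorphism.Build _ _ (bieval h a b) bieval_is_monoid.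

Local Notation bieval := (bieval h a b).

Lemma bievalC c : bieval c%:MP = h c.
Proof. by rewrite bieval_mmap mmapC. Qed.

Lemma bieval_X m : bieval 'X_[m] = a ^+ m 0 * b ^+ m 1.
Proof. by rewrite bieval_mmap mmapX /mmap1 big_ord2. Qed.

Lemma bieval_X0 : bieval 'X_0 = a.
Proof. by rewrite bieval_mmap mmapX mmap1U. Qed.

Lemma bieval_X1 : bieval 'X_1 = b.
Proof. by rewrite bieval_mmap mmapX mmap1U. Qed.

Lemma bievalZ c p : bieval (c *: p) = h c * bieval p.
Proof. by rewrite bieval_mmap mmapZ. Qed.

Lemma bievalE p :
  bieval p = \sum_(m <- msupp p) h p@_m * (a ^+ m 0 * b ^+ m 1).
Proof.
rewrite {1}[p]mpolyE rmorph_sum; apply: eq_bigr => m _.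
by rewrite /= bievalZ bieval_X.
Qed.

Lemma bieval_unique (t : {rmorphism {mpoly K[2]} -> S}) :
  (forall c, t c%:MP = h c) -> t 'X_0 = a -> t 'X_1 = b -> t =1 bieval.
Proof.
move=> tC t0 t1 p; rewrite bievalE {1}[p]mpolyE rmorph_sum.
apply: eq_bigr => m _; rewrite -mul_mpolyC rmorphM tC; congr (_ * _).
by rewrite mpolyXE_id big_ord2 rmorphM !rmorphXn /= t0 t1.
Qed.

End Bieval.

Lemma bieval_comp (K : fieldType) (S S' : comNzRingType) (h : {rmorphism K -> S})
    (h' : {rmorphism K -> S'}) (t : {rmorphism S -> S'}) a b p :
  (forall c, t (h c) = h' c) ->
  t (bieval h a b p) = bieval h' (t a) (t b) p.
Proof.
move=> tC; rewrite -[LHS]/((t \o bieval h a b) p); apply: bieval_unique => [c||] /=.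
- by rewrite bievalC tC.
- by rewrite bieval_X0.
- by rewrite bieval_X1.
Qed.

HB.lock Definition sub2 (K : fieldType) (a b p : {mpoly K[2]}) : {mpoly K[2]} :=
  bieval (@mpolyC 2 K) a b p.

Section Substitution.
Variable K : fieldType.
Implicit Types (a b p q : {mpoly K[2]}).

Lemma sub2_bieval a b : sub2 a b = bieval (@mpolyC 2 K) a b.
Proof. by rewrite unlock. Qed.

Let sub2_is_zmod a b : zmod_morphism (sub2 a b).
Proof. by rewrite sub2_bieval; exact: raddfB. Qed.

Let sub2_is_monoid a b : monoid_morphism (sub2 a b).
Proof. by rewrite sub2_bieval; split; [exact: rmorph1 | exact: rmorphM]. Qed.

HB.instance Definition _ a b := GRing.isZmodMorphism.Build _ _ (sub2 a b) (sub2_is_zmod a b).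
HB.instance Definition _ a b := GRing.isMonoidMorphism.Build _ _ (sub2 a b) (sub2_is_monoid a b).

Lemma sub2C a b c : sub2 a b c%:MP = c%:MP.
Proof. by rewrite sub2_bieval bievalC. Qed.

Lemma sub2_X0 a b : sub2 a b 'X_0 = a.
Proof. by rewrite sub2_bieval bieval_X0. Qed.

Lemma sub2_X1 a b : sub2 a b 'X_1 = b.
Proof. by rewrite sub2_bieval bieval_X1. Qed.

Lemma sub2Z a b c p : sub2 a b (c *: p) = c *: sub2 a b p.
Proof. by rewrite sub2_bieval bievalZ mul_mpolyC. Qed.

Lemma sub2E a b p :
  sub2 a b p = \sum_(m <- msupp p) p@_m *: (a ^+ m 0 * b ^+ m 1).
Proof.
by rewrite sub2_bieval bievalE; apply: eq_bigr => m _; rewrite mul_mpolyC.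
Qed.

Lemma bieval_sub2 (S : comNzRingType) (h : {rmorphism K -> S}) u v a b p :
  bieval h u v (sub2 a b p) = bieval h (bieval h u v a) (bieval h u v b) p.
Proof.
rewrite [sub2 _ _]sub2_bieval.
by apply: (bieval_comp _ (t := bieval h u v)) => c; exact: bievalC.
Qed.

Lemma sub2_comp u v a b p :
  sub2 u v (sub2 a b p) = sub2 (sub2 u v a) (sub2 u v b) p.
Proof. by rewrite [sub2 u v]sub2_bieval bieval_sub2 [in RHS]sub2_bieval. Qed.

Lemma sub2_id p : sub2 'X_0 'X_1 p = p.
Proof.
rewrite sub2_bieval; apply/esym.
by apply: (@bieval_unique _ _ (@mpolyC 2 K) 'X_0 'X_1 idfun).
Qed.

(* (f, g) is a pair of images of the variables under an automorphism. *)
Definition autpair (f g : {mpoly K[2]}) := exists F G,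
  [/\ sub2 f g F = 'X_0, sub2 f g G = 'X_1,
      sub2 F G f = 'X_0 & sub2 F G g = 'X_1].

Lemma autpair_sub2 f g a b :
  autpair f g -> autpair a b -> autpair (sub2 a b f) (sub2 a b g).
Proof.
move=> [F [G [FE GE fE gE]]] [A [B [AE BE aE bE]]].
have e u : sub2 (sub2 a b f) (sub2 a b g) (sub2 F G u) = sub2 a b u.
  by rewrite sub2_comp -(sub2_comp a b f g F) -(sub2_comp a b f g G) FE GE
             sub2_X0 sub2_X1.
have e' u : sub2 (sub2 F G A) (sub2 F G B) (sub2 a b u) = sub2 F G u.
  by rewrite sub2_comp -(sub2_comp F G A B a) -(sub2_comp F G A B b) aE bE
             sub2_X0 sub2_X1.
by exists (sub2 F G A), (sub2 F G B); split; rewrite ?e ?e'.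
Qed.

End Substitution.

(** * Polynomials fixed by a deformation *)

Lemma derivation_exp (S : comNzRingType) (d : S -> S) x n :
  (forall y z, d (y * z) = d y * z + y * d z) ->
  d (x ^+ n.+1) = n.+1%:R * x ^+ n * d x.
Proof.
move=> dM; elim: n => [|n IH]; first by rewrite expr1 expr0 !mul1r.
by rewrite exprS dM IH [n.+2%:R]mulrS [x ^+ n.+1]exprS; ring.
Qed.

(** Here [{poly {mpoly K[2]}}] is K[x,y][t], with t the parameter of a family, and the value is
    p(X(t), Y(t)). *)
HB.lock Definition evt (K : fieldType) (X Y : {poly {mpoly K[2]}})
  (p : {mpoly K[2]}) : {poly {mpoly K[2]}} := bieval (polyC \o @mpolyC 2 K) X Y p.

Section Deformation.
Variable K : fieldType.
Local Notation R2 := {mpoly K[2]}.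
Implicit Types (X Y P Q : {poly R2}) (p q : R2).

Lemma evt_bieval X Y : evt X Y = bieval (polyC \o @mpolyC 2 K) X Y.
Proof. by rewrite unlock. Qed.

Let evt_is_zmod X Y : zmod_morphism (evt X Y).
Proof. by rewrite evt_bieval; exact: raddfB. Qed.

Let evt_is_monoid X Y : monoid_morphism (evt X Y).
Proof. by rewrite evt_bieval; split; [exact: rmorph1 | exact: rmorphM]. Qed.

HB.instance Definition _ X Y := GRing.isZmodMorphism.Build _ _ (evt X Y) (evt_is_zmod X Y).
HB.instance Definition _ X Y := GRing.isMonoidMorphism.Build _ _ (evt X Y) (evt_is_monoid X Y).

Lemma evtC X Y c : evt X Y c%:MP = c%:MP%:P.
Proof. by rewrite evt_bieval bievalC. Qed.

Lemma evt_X0 X Y : evt X Y 'X_0 = X.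
Proof. by rewrite evt_bieval bieval_X0. Qed.

Lemma evt_X1 X Y : evt X Y 'X_1 = Y.
Proof. by rewrite evt_bieval bieval_X1. Qed.

Lemma evt_X X Y m : evt X Y 'X_[m] = X ^+ m 0 * Y ^+ m 1.
Proof. by rewrite evt_bieval bieval_X. Qed.

Lemma evtE X Y p :
  evt X Y p = \sum_(m <- msupp p) (p@_m)%:MP%:P * (X ^+ m 0 * Y ^+ m 1).
Proof. by rewrite evt_bieval bievalE. Qed.

Lemma evt_sub2 X Y a b p : evt X Y (sub2 a b p) = evt (evt X Y a) (evt X Y b) p.
Proof. by rewrite [evt X Y]evt_bieval bieval_sub2 evt_bieval. Qed.

Lemma evt_polyC a b p : evt a%:P b%:P p = (sub2 a b p)%:P.
Proof.
by rewrite evt_bieval sub2_bieval; apply/esym; apply: (bieval_comp _ (t := polyC)).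
Qed.

Lemma evt_coef0 X Y p : (evt X Y p)`_0 = sub2 X`_0 Y`_0 p.
Proof.
rewrite -!horner_coef0 evt_bieval sub2_bieval -/(horner_eval 0 _).
by apply: (bieval_comp _ (t := horner_eval 0)) => c /=; rewrite /horner_eval hornerC.
Qed.

(* A nontrivial algebraic family of endomorphisms (X, Y), parametrized by the
   variable of {poly R2}, which is the identity at parameter 0. *)
Definition deformation X Y : Prop :=
  [/\ X`_0 = 'X_0, Y`_0 = 'X_1 & ~ (X = ('X_0)%:P /\ Y = ('X_1)%:P)].

Definition fixed X Y p : Prop := evt X Y p = p%:P.

Definition stabilized p : Prop := exists X Y, deformation X Y /\ fixed X Y p.

Section Factors.
Variables X Y : {poly R2}.
Hypothesis defXY : deformation X Y.

Lemma def_coef0 p : (evt X Y p)`_0 = p.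
Proof. by case: defXY => X0 Y0 _; rewrite evt_coef0 X0 Y0 sub2_id. Qed.

Lemma def_size1 p : (size (evt X Y p) <= 1)%N -> fixed X Y p.
Proof. by rewrite /fixed => /size1_polyC ->; rewrite def_coef0. Qed.

(** K[x,y] is a domain, so a nonzero product constant in t has factors constant in t; the image of p
    is then its value at t = 0, which is p. *)
Lemma fixed_factor p q : p * q != 0 -> fixed X Y (p * q) -> fixed X Y p.
Proof.
move=> pq0 fpq; apply: def_size1; move: (fpq); rewrite /fixed rmorphM /= => e.
have: size (evt X Y p * evt X Y q) == 1%N by rewrite e size_polyC pq0.
by rewrite size_mul_eq1 => /andP[/eqP-> _].
Qed.

Lemma fixed_exp p n : p != 0 -> fixed X Y (p ^+ n.+1) -> fixed X Y p.
Proof.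
by move=> p0; rewrite exprS; apply: fixed_factor; rewrite -exprS expf_neq0.
Qed.

Lemma fixedD p q : fixed X Y p -> fixed X Y q -> fixed X Y (p + q).
Proof. by rewrite /fixed rmorphD /= polyCD => -> ->. Qed.

Lemma fixedZ c p : fixed X Y p -> fixed X Y (c *: p).
Proof. by rewrite /fixed -mul_mpolyC rmorphM /= polyCM evtC => ->. Qed.

Lemma fixedZ_inv c p : c != 0 -> fixed X Y (c *: p) -> fixed X Y p.
Proof.
by move=> c0 fp; rewrite -[p](scalerK c0); apply: fixedZ.
Qed.

Lemma not_both_fixed : fixed X Y 'X_0 -> fixed X Y 'X_1 -> False.
Proof.
by rewrite /fixed evt_X0 evt_X1 => e0 e1; case: defXY => _ _; apply.
Qed.

End Factors.

Definition pder (i : 'I_2) P : {poly R2} := map_poly (mderiv i) P.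

Lemma pder_coef i P k : (pder i P)`_k = (P`_k)^`M(i).
Proof. by rewrite coef_map. Qed.

Lemma pderM i P Q : pder i (P * Q) = pder i P * Q + P * pder i Q.
Proof.
apply/polyP=> k; rewrite coefD pder_coef !coefM raddf_sum -big_split /=.
by apply: eq_bigr => j _; rewrite mderivM !pder_coef.
Qed.

Lemma pderC i p : pder i p%:P = (p^`M(i))%:P.
Proof. by rewrite /pder map_polyC. Qed.

Lemma pder_exp i P n : pder i (P ^+ n.+1) = n.+1%:R * P ^+ n * pder i P.
Proof. by apply: derivation_exp; exact: pderM. Qed.

Lemma size_pder i P : (size (pder i P) <= size P)%N.
Proof. by apply/leq_sizeP => k kP; rewrite pder_coef nth_default ?mderiv0. Qed.

Lemma mderiv_exp i p n : (p ^+ n.+1)^`M(i) = n.+1%:R * p ^+ n * p^`M(i).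
Proof. by apply: derivation_exp; exact: mderivM. Qed.

Lemma mderiv_var (i j : 'I_2) : ('X_i : R2)^`M(j) = (i == j)%:R.
Proof.
rewrite mderivX mnm1E; case: eqP => [->|_]; last by rewrite scale0r.
have -> : (U_(j) - U_(j) = 0)%MM by apply/mnmP => l; rewrite mnmBE mnm0E subnn.
by rewrite scale1r mpolyX0.
Qed.

End Deformation.

(** The derivation a d/dx - b d/dy kills D when b and a are the x- and y-derivatives of D. In the
    application D = Y^p - c X^q, with P = p Y^(p-1) and Q = q X^(q-1), and the x's and y's are the
    partial derivatives of X and Y. *)
Lemma hamilton_relation (S : comNzRingType) (P Q c a b x0 x1 y0 y1 : S) :
  P * y0 - c * (Q * x0) = b -> P * y1 - c * (Q * x1) = a ->
  P * (a * y0 - b * y1) = c * (Q * (a * x0 - b * x1)).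
Proof. by move=> <- <-; ring. Qed.

Lemma wronskian_relation (S : comNzRingType) (p q c D X Xq Y Yp dX dY : S) :
  Y * Yp - c * (X * Xq) = D -> p * Yp * dY = c * (q * Xq * dX) ->
  Yp * (p * X * dY - q * Y * dX) = - (q * D * dX) /\
  c * Xq * (p * X * dY - q * Y * dX) = - (p * D * dY).
Proof.
move=> <- e; split.
  have -> : Yp * (p * X * dY - q * Y * dX) = X * (p * Yp * dY) - Yp * q * Y * dX by ring.
  by rewrite e; ring.
have -> : c * Xq * (p * X * dY - q * Y * dX) =
    p * X * dY * (c * Xq) - Y * (c * (q * Xq * dX)) by ring.
by rewrite -e; ring.
Qed.

(** Degrees in t are compared in the two identities of [wronskian_relation]. P, Q, c and D are
    constant in t, and the factor W, nonzero because the right side is, can only raise the degree of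
    the left side. *)
Lemma wronskian_size (R : idomainType) (p q : nat) (P Q c D X Y dX dY : {poly R}) :
  size P = 1%N -> size Q = 1%N -> size c = 1%N -> size D = 1%N ->
  dX != 0 -> X != 0 -> (size dX <= size X)%N -> (size dY <= size Y)%N ->
  Y ^+ p.+1 - c * X ^+ q.+1 = D -> P * Y ^+ p * dY = c * (Q * X ^+ q * dX) ->
  (p * (size Y).-1 <= (size X).-1)%N /\ (q * (size X).-1 <= (size Y).-1)%N.
Proof.
move=> sP sQ sc sD dX0 X0 sdX sdY; rewrite !exprS => e1 e2.
have [E1 E2] := wronskian_relation e1 e2.
have nz (A : {poly R}) : size A = 1%N -> A != 0 by rewrite -size_poly_gt0 => ->.
have sz (u A : {poly R}) : size u = 1%N -> size (u * A) = size A.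
  move=> su; have [->|A0] := eqVneq A 0; first by rewrite mulr0.
  by rewrite size_mul ?(nz _ su) // su.
have lem (A : {poly R}) (n : nat) (W B u v : {poly R}) : size u = 1%N -> size v = 1%N -> B != 0 ->
    u * A ^+ n * W = - (v * D * B) -> (n * (size A).-1 <= (size B).-1)%N.
  move=> su sv B0 e.
  have r0 : - (v * D * B) != 0 by rewrite oppr_eq0; apply: mulf_neq0 B0; apply: mulf_neq0; apply: nz.
  have : u * A ^+ n * W != 0 by rewrite e.
  rewrite -mulrA !mulf_eq0 !negb_or => /and3P[u0 An0 W0].
  have := congr1 (fun T : {poly R} => size T) e.
  rewrite /= size_polyN -!mulrA (sz u) // (sz v) // (sz D) // size_mul //.
  have := size_exp A n; rewrite -size_poly_gt0 in W0; rewrite -size_poly_gt0 in An0.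
  by rewrite mulnC => <- <-; rewrite -!subn1; lia.
have h1 : (p * (size Y).-1 <= (size X).-1)%N.
  apply: leq_trans (lem Y p _ dX 1 Q (size_poly1 _) sQ dX0 _) _; last by rewrite -!subn1 leq_sub2r.
  by rewrite mul1r; exact: E1.
have dY0 : dY != 0.
  apply: contraNneq dX0 => dY0; move: E1; rewrite dY0 mulr0 sub0r => E1.
  move/eqP: e2; rewrite dY0 mulr0 eq_sym !mulf_eq0 (negPf (nz _ sc)) (negPf (nz _ sQ)).
  by rewrite expf_eq0 (negPf X0) andbF.
split=> //; apply: leq_trans (lem X q _ dY c P sc sP dY0 E2) _; by rewrite -!subn1 leq_sub2r.
Qed.

Section Cuspidal.
Variable K : fieldType.
Local Notation R2 := {mpoly K[2]}.
Implicit Types (X Y P Q : {poly R2}).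

Lemma size_exp_const P n (c : R2) : P != 0 -> (0 < n)%N ->
  P ^+ n = c%:P -> (size P <= 1)%N.
Proof.
move=> P0 n0 e; have := size_exp P n; rewrite e size_polyC.
case: eqP => _ /= /esym/eqP; rewrite muln_eq0 (gtn_eqF n0) orbF;
by rewrite -subn1 subn_eq0.
Qed.

(* A curve y^p = z x^q with a cusp is not moved by a nontrivial deformation: a
   derivation d killing y^p - z x^q gives Y^(p-1) W = - q (y^p - z x^q) d X and
   X^(q-1) z W = - p (y^p - z x^q) d Y with W = p X (d Y) - q Y (d X), which
   bounds the degrees of X and Y in the parameter. If p or q vanishes in K, a
   partial derivative suffices. *)
Lemma cusp_not_fixed X Y (p q : nat) (z : K) :
  deformation X Y -> (1 < p)%N -> (1 < q)%N -> coprime p q -> z != 0 ->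
  ~ fixed X Y ('X_1 ^+ p - z *: 'X_0 ^+ q).
Proof.
move=> dXY p1 q1 cpq z0 fD; have [X0 Y0 ntr] := dXY.
case: p q p1 q1 cpq fD => [//|p] [//|q]; rewrite !ltnS => p0 q0 cpq fD.
set D : R2 := 'X_1 ^+ p.+1 - z *: 'X_0 ^+ q.+1 in fD.
pose c : {poly R2} := (z%:MP)%:P.
have c0 : c != 0 by rewrite !(polyC_eq0, mpolyC_eq0).
have eD : Y ^+ p.+1 - c * X ^+ q.+1 = D%:P.
  move: fD; rewrite /fixed {1}/D rmorphB /= -mul_mpolyC rmorphM /= evtC.
  by rewrite !rmorphXn /= evt_X0 evt_X1.
have Xn0 : X != 0.
  apply/eqP => Xe; move: X0; rewrite Xe coef0 => /eqP.
  by rewrite eq_sym -msize_poly_eq0 msizeX.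
have Yn0 : Y != 0.
  apply/eqP => Ye; move: Y0; rewrite Ye coef0 => /eqP.
  by rewrite eq_sym -msize_poly_eq0 msizeX.
have triv : (size X <= 1)%N -> (size Y <= 1)%N -> False.
  by move=> /size1_polyC eX /size1_polyC eY; apply: ntr; rewrite eX eY X0 Y0.
have pcn i : pder i c = 0 by rewrite pderC mderivC.
have eder i : p.+1%:R * Y ^+ p * pder i Y - c * (q.+1%:R * X ^+ q * pder i X) =
    (D^`M(i))%:P.
  by rewrite -pderC -eD /pder raddfB /= -!/(pder i _) pderM pcn mul0r add0r !pder_exp.
have dD0 : D^`M(0) = - (z *: (q.+1%:R * 'X_0 ^+ q)).
  by rewrite /D mderivB mderivZ !mderiv_exp !mderiv_var /= !mulr0 sub0r mulr1.
have dD1 : D^`M(1) = p.+1%:R * 'X_1 ^+ p.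
  by rewrite /D mderivB mderivZ !mderiv_exp !mderiv_var /= !mulr0 scaler0 subr0 mulr1.
have natE n : n%:R = ((n%:R : K)%:MP)%:P :> {poly R2} by rewrite !rmorph_nat.
have nat0 n : (n%:R == 0 :> {poly R2}) = (n%:R == 0 :> K).
  by rewrite natE polyC_eq0 mpolyC_eq0.
have nat0' n : (n%:R == 0 :> R2) = (n%:R == 0 :> K) by rewrite -polyC_eq0 rmorph_nat.
have not_both : p.+1%:R = 0 :> K -> q.+1%:R = 0 :> K -> False.
  move=> pz qz; have [u /= eu] := coprimeP q.+1 (ltn0Sn p) cpq.
  have : (u.1 * p.+1 = 1 + u.2 * q.+1)%N by lia.
  move/(congr1 (fun k => k%:R : K)); rewrite natrD !natrM pz qz !mulr0 addr0.
  by move/eqP; rewrite eq_sym oner_eq0.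
have vX n : ('X_0 : R2) ^+ n != 0 by rewrite expf_neq0 // -msize_poly_eq0 msizeX.
have vY n : ('X_1 : R2) ^+ n != 0 by rewrite expf_neq0 // -msize_poly_eq0 msizeX.
have size_factor A B (v : R2) n : A ^+ n * B = v%:P -> v != 0 -> A != 0 -> (0 < n)%N ->
    (size A <= 1)%N.
  move=> e v0 A0 n0; have : size (A ^+ n * B) == 1%N by rewrite e size_polyC v0.
  rewrite size_mul_eq1 => /andP[/size_poly1P[r _ er] _].
  exact: size_exp_const er.
(* The y-derivative of the relation becomes Y^p Y_y = y^p, whose right side is constant in t; hence
   Y is constant in t, and then X. The case below, where the other exponent vanishes in K, uses the
   x-derivative. *)
have [qz|qnz] := eqVneq (q.+1%:R : K) 0.
  have pnz : p.+1%:R != 0 :> {poly R2} by rewrite nat0; apply/eqP => /not_both; apply.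
  have eY : Y ^+ p * pder 1 Y = ('X_1 ^+ p)%:P.
    apply: (mulfI pnz); have := eder 1; rewrite dD1 polyCM rmorph_nat mulrA => <-.
    by rewrite (natE q.+1) qz mpolyC0 polyC0 !(mul0r, mulr0) subr0 mulrA.
  have sY := size_factor _ _ _ _ eY (vY _) Yn0 p0.
  apply: (triv _ sY); apply: (size_exp_const Xn0 (ltn0Sn q) (c := 'X_0 ^+ q.+1)).
  apply: (mulfI c0); move/eqP: eD; rewrite (size1_polyC sY) Y0 subr_eq addrC -subr_eq => /eqP <-.
  by rewrite -rmorphXn -polyCB /D subKr -mul_mpolyC polyCM.
have [pz|pnz] := eqVneq (p.+1%:R : K) 0.
  have eX : X ^+ q * pder 0 X = ('X_0 ^+ q)%:P.
    have qnz' : q.+1%:R != 0 :> {poly R2} by rewrite nat0.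
    apply: (mulfI qnz'); apply: (mulfI c0); have := eder 0.
    rewrite dD0 -mul_mpolyC polyCN !polyCM rmorph_nat -/c (natE p.+1) pz mpolyC0 polyC0 => e.
    by apply: oppr_inj; rewrite -e !(mul0r, mulr0) sub0r !mulrA.
  have sX := size_factor _ _ _ _ eX (vX _) Xn0 q0.
  apply: (triv sX); apply: (size_exp_const Yn0 (ltn0Sn p) (c := 'X_1 ^+ p.+1)).
  move/eqP: eD; rewrite (size1_polyC sX) X0 subr_eq => /eqP ->.
  by rewrite -rmorphXn /c -polyCM -polyCD /D mul_mpolyC subrK.
pose a : {poly R2} := (D^`M(1))%:P; pose b : {poly R2} := (D^`M(0))%:P.
pose d P := a * pder 0 P - b * pder 1 P.
have ed : p.+1%:R * Y ^+ p * d Y = c * (q.+1%:R * X ^+ q * d X).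
  exact: hamilton_relation (eder 0) (eder 1).
have size_d P : (size (d P) <= size P)%N.
  rewrite /d /a /b !mul_polyC (leq_trans (size_polyD _ _)) // size_polyN geq_max.
  by rewrite !(leq_trans (size_scale_leq _ _)) ?size_pder.
have Dn0 : D != 0.
  apply: contraNneq pnz => D0; have := dD1; rewrite D0 mderiv0 => /esym/eqP.
  by rewrite mulf_eq0 (negPf (vY _)) orbF nat0'.
have dXn0 : d X != 0.
  suff e : (d X)`_0 = D^`M(1).
    apply: contraNneq pnz => dX0; move: e; rewrite dX0 coef0 dD1 => /esym/eqP.
    by rewrite mulf_eq0 (negPf (vY _)) orbF nat0'.
  rewrite /d /a /b !mul_polyC coefB !coefZ !pder_coef X0 !mderiv_var.
  by rewrite mulr1 mulr0 subr0.
have [sz1 sz2] : (p * (size Y).-1 <= (size X).-1)%N /\ (q * (size X).-1 <= (size Y).-1)%N.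
  apply: (wronskian_size _ _ _ _ _ _ _ _ eD ed) => //.
  - by rewrite natE size_polyC mpolyC_eq0 pnz.
  - by rewrite natE size_polyC mpolyC_eq0 qnz.
  - by rewrite size_polyC mpolyC_eq0 z0.
  - by rewrite size_polyC Dn0.
(* [p] and [q] are now the exponents minus one. Coprime exponents are not both 2, so p q >= 2 and
   the two bounds leave only degree 0. *)
have pq2 : (p != 1%N) || (q != 1%N).
  by case: (p =P 1%N) cpq => [->|//]; case: (q =P 1%N) => [->|].
have sX : ((size X).-1 = 0)%N by nia.
have sY : ((size Y).-1 = 0)%N by nia.
by apply: triv; rewrite -subn_eq0 subn1 ?sX ?sY.
Qed.

End Cuspidal.

(** * Initial forms *)

Lemma coefM_top (R : nzRingType) (P Q : {poly R}) a b :
  (size P <= a.+1)%N -> (size Q <= b.+1)%N -> (P * Q)`_(a + b) = P`_a * Q`_b.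
Proof.
move=> sP sQ; rewrite coefM (bigD1 (inord a)) //= inordK ?ltnS ?leq_addr // addKn.
rewrite big1 ?addr0 // => i; rewrite -val_eqE /= inordK ?ltnS ?leq_addr // => ia.
have [lt_ai|le_ia] := ltnP a i; first by rewrite [P`_i]nth_default ?mul0r // (leq_trans sP).
by rewrite [Q`__]nth_default ?mulr0 // (leq_trans sQ) // ltn_subRL; have := ia; lia.
Qed.

Section Weights.
Variables (K : fieldType) (w0 w1 : nat).
Local Notation R2 := {mpoly K[2]}.
Implicit Types (p q : R2) (P Q X Y : {poly R2}).

Definition wt (m : 'X_{1..2}) : nat := (w0 * m 0%R + w1 * m 1%R)%N.

Definition wle d p : Prop := forall m, m \in msupp p -> (wt m <= d)%N.

Definition wform d p : R2 := \sum_(m <- msupp p | wt m == d) p@_m *: 'X_[m].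

Lemma mcoeff_wform d p m : (wform d p)@_m = if wt m == d then p@_m else 0.
Proof.
rewrite /wform [LHS]raddf_sum /=.
under eq_bigr do rewrite mcoeffZ mcoeffX.
have [mp|mp] := boolP (m \in msupp p); last first.
  rewrite big1_seq; first by rewrite (memN_msupp_eq0 mp) if_same.
  move=> m' /andP[_ m'p]; case: eqP => [e|]; last by rewrite mulr0.
  by rewrite e (negPf mp) in m'p.
rewrite big_mkcond (bigD1_seq m) ?msupp_uniq //= eqxx mulr1 big1 ?addr0 //.
by move=> m' /negPf ->; rewrite mulr0 if_same.
Qed.

(* p(x s^w0, y s^w1) as a polynomial in s. *)
Definition wtwist p : {poly R2} := evt (('X_0)%:P * 'X^w0) (('X_1)%:P * 'X^w1) p.

Lemma wtwistM p q : wtwist (p * q) = wtwist p * wtwist q.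
Proof. exact: rmorphM. Qed.

Lemma wtwist1 : wtwist 1 = 1. Proof. exact: rmorph1. Qed.

Lemma wtwist0 : wtwist 0 = 0. Proof. exact: rmorph0. Qed.

Lemma wtwist_sum (I : Type) (r : seq I) (F : I -> R2) :
  wtwist (\sum_(i <- r) F i) = \sum_(i <- r) wtwist (F i).
Proof. exact: rmorph_sum. Qed.

Lemma wtwistE p : wtwist p = \sum_(m <- msupp p) (p@_m *: 'X_[m]) *: 'X^(wt m).
Proof.
rewrite /wtwist evtE; apply: eq_bigr => m _.
rewrite !exprMn -!exprM mulrACA -exprD -/(wt m) -!rmorphXn /= -rmorphM mulrA -rmorphM /=.
by rewrite mul_polyC mul_mpolyC [in RHS]mpolyXE_id big_ord2.
Qed.

Lemma coef_wtwist p d : (wtwist p)`_d = wform d p.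
Proof.
rewrite wtwistE coef_sum /wform [RHS]big_mkcond; apply: eq_bigr => m _.
by rewrite coefZ coefXn eq_sym /=; case: eqP; rewrite ?mulr1 ?mulr0.
Qed.

Lemma size_wtwist d p : wle d p -> (size (wtwist p) <= d.+1)%N.
Proof.
move=> pd; apply/leq_sizeP => j dj; rewrite coef_wtwist /wform big1_seq // => m.
by move=> /andP[/eqP mj /pd]; rewrite mj leqNgt dj.
Qed.

Variable N : nat.

(* The weight of the parameter is -N. *)
Definition tle d P : Prop := forall l, (size (wtwist P`_l) <= (d + N * l).+1)%N.

(** A monomial of weight e in the coefficient of t^l has weight e - N l in all; this is the part of
    weight d. *)
Definition tform d P : {poly R2} := \poly_(l < size P) wform (d + N * l)%N P`_l.

Lemma wform0 d : wform d 0 = 0.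
Proof. by rewrite /wform msupp0 big_nil. Qed.

Lemma coef_tform d P l : (tform d P)`_l = (wtwist P`_l)`_(d + N * l).
Proof.
rewrite coef_poly coef_wtwist; case: ltnP => // Pl.
by rewrite nth_default // wform0.
Qed.

Lemma tform_polyC d p : tform d p%:P = (wform d p)%:P.
Proof.
apply/polyP => l; rewrite (coef_tform d p%:P l) (coef_wtwist (p%:P)`_l).
rewrite [in LHS]coefC [in RHS]coefC.
by case: eqP => [->|_]; rewrite ?wform0 // muln0 addn0.
Qed.

Lemma tleM d e P Q : tle d P -> tle e Q -> tle (d + e)%N (P * Q).
Proof.
move=> Pd Qe l; rewrite coefM wtwist_sum.
apply: (leq_trans (size_sum _ _ _)); apply/bigmax_leqP => i _; rewrite wtwistM.
apply: (leq_trans (size_polyMleq _ _)).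
have := Pd i; have := Qe (l - i)%N; have := ltn_ord i.
move: (size (wtwist P`_i)) (size _) => a b; nia.
Qed.

Lemma tformM d e P Q : tle d P -> tle e Q ->
  tform (d + e)%N (P * Q) = tform d P * tform e Q.
Proof.
move=> Pd Qe; apply/polyP => l; rewrite coef_tform !coefM wtwist_sum coef_sum.
apply: eq_bigr => i _; rewrite !coef_tform wtwistM -coefM_top //.
by congr (_`_ _); have := ltn_ord i; nia.
Qed.

Lemma tleX d P n : tle d P -> tle (d * n)%N (P ^+ n).
Proof.
move=> Pd; elim: n => [|n IH]; last by rewrite exprS mulnS; apply: tleM.
move=> l; rewrite expr0 coef1; case: eqP => _.
  by rewrite wtwist1 size_poly1.
by rewrite wtwist0 size_poly0.
Qed.

Lemma tformX d P n : tle d P -> tform (d * n)%N (P ^+ n) = tform d P ^+ n.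
Proof.
move=> Pd; elim: n => [|n IH]; last first.
  by rewrite !exprS mulnS tformM ?IH //; apply: tleX.
apply/polyP => l; rewrite !expr0 coef_tform !coef1 muln0 add0n.
case: l => [|l]; first by rewrite muln0 wtwist1 coef1.
by rewrite wtwist0 coef0.
Qed.

(** Taking top parts commutes with substitution when X and Y weigh no more than the variables they
    replace: a monomial of p of weight below d cannot reach weight d. *)
Lemma tform_evt X Y p d : tle w0 X -> tle w1 Y -> wle d p ->
  tform d (evt X Y p) = evt (tform w0 X) (tform w1 Y) (wform d p).
Proof.
move=> tX tY pd; apply/polyP => l; rewrite coef_tform evtE coef_sum wtwist_sum coef_sum.
rewrite /wform rmorph_sum /= coef_sum [RHS]big_mkcond [LHS]big_seq_cond [RHS]big_seq_cond.
apply: eq_bigr => m /andP[mp _].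
set Q := X ^+ m 0 * Y ^+ m 1.
have tQ : tle (wt m) Q by apply: tleM; apply: tleX.
have tlc : (wtwist (((p@_m)%:MP)%:P * Q)`_l) = (((p@_m)%:MP)%:P) * wtwist Q`_l.
  by rewrite coefCM wtwistM /wtwist evtC.
rewrite tlc coefCM; case: eqP => [<-|/eqP md].
  rewrite -coef_tform tformM ?tformX //; try exact: tleX.
  by rewrite -mul_mpolyC rmorphM /= evtC evt_X coefCM.
rewrite nth_default ?mulr0 //; apply: leq_trans (tQ l) _.
by have := pd m mp; rewrite leq_eqVlt (negPf md) /= => h; lia.
Qed.

End Weights.

Section Degeneration.
Variable K : fieldType.
Local Notation R2 := {mpoly K[2]}.
Implicit Types (f p : R2) (P : {poly R2}).

Lemma coef_comp_scaleX (R : comNzRingType) (P : {poly R}) c l :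
  (P \Po (c *: 'X))`_l = P`_l * c ^+ l.
Proof.
rewrite coef_comp_poly; under eq_bigr do rewrite exprZn coefZ coefXn.
have [lP|Pl] := ltnP l (size P).
  rewrite (bigD1 (Ordinal lP)) //= eqxx mulr1 big1 ?addr0 // => i.
  by rewrite -val_eqE eq_sym /= => /negPf ->; rewrite !mulr0.
rewrite nth_default // mul0r big1 // => i _.
by rewrite (gtn_eqF (leq_trans (ltn_ord i) Pl)) !mulr0.
Qed.

Lemma evt_comp_poly (X Y c : {poly R2}) p :
  evt (X \Po c) (Y \Po c) p = evt X Y p \Po c.
Proof.
rewrite !evt_bieval; apply/esym.
by apply: (bieval_comp _ (t := comp_poly c)) => k; exact: comp_polyC.
Qed.

Lemma wform_scale w0 w1 B d p : (0 < B)%N ->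
  wform (B * w0) (B * w1) (B * d) p = wform w0 w1 d p.
Proof.
move=> B0; apply/mpolyP => m; rewrite !mcoeff_wform.
suff -> : wt (B * w0) (B * w1) m = (B * wt w0 w1 m)%N by rewrite eqn_pmul2l.
by rewrite /wt mulnDr !mulnA.
Qed.

Lemma wform_X0 w0 w1 : wform w0 w1 w0 'X_0 = 'X_0 :> R2.
Proof.
apply/mpolyP => m; rewrite mcoeff_wform mcoeffX.
by case: (mnm1 0 =P m) => [<-|_]; rewrite ?if_same // /wt !mnm1E /= muln1 muln0 addn0 eqxx.
Qed.

Lemma wform_X1 w0 w1 : wform w0 w1 w1 'X_1 = 'X_1 :> R2.
Proof.
apply/mpolyP => m; rewrite mcoeff_wform mcoeffX.
by case: (mnm1 1 =P m) => [<-|_]; rewrite ?if_same // /wt !mnm1E /= muln1 muln0 eqxx.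
Qed.

Lemma deformation_coef (X Y : {poly R2}) : deformation X Y ->
  exists2 l, (0 < l)%N & (X`_l != 0) || (Y`_l != 0).
Proof.
case=> X0 Y0 ntr; apply: contrapT => h; apply: ntr.
have z l : (0 < l)%N -> X`_l = 0 /\ Y`_l = 0.
  move=> l0; apply: contrapT => hl; apply: h; exists l => //.
  apply: contra_notT hl; rewrite negb_or !negbK => /andP[/eqP-> /eqP->] //.
by split; apply/polyP => -[|l]; rewrite coefC /= ?X0 ?Y0 //; case: (z l.+1).
Qed.

(* Replacing the parameter t by x^M t makes all weights of the coefficients at
   t large, so that the slope N of the initial form in t is positive; scaling the
   weights by B makes it an integer. *)
Lemma stabilized_wform f w0 w1 d : (0 < w0)%N -> wle w0 w1 d f ->
  stabilized f -> stabilized (wform w0 w1 d f).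
Proof.
move=> w00 fd [X [Y [dXY fXY]]].
pose M := (w0 + w1).+1; pose c : {poly R2} := 'X_0 ^+ M *: 'X.
pose X' : {poly R2} := X \Po c; pose Y' : {poly R2} := Y \Po c.
have X'E l : X'`_l = X`_l * ('X_0 ^+ M) ^+ l by exact: coef_comp_scaleX.
have Y'E l : Y'`_l = Y`_l * ('X_0 ^+ M) ^+ l by exact: coef_comp_scaleX.
have [X0 Y0 _] := dXY.
have fXY' : evt X' Y' f = f%:P by rewrite evt_comp_poly fXY comp_polyC.
clearbody X' Y'.
(* B is divisible by every l from 1 to n, so the slopes taken below are integers. *)
pose n := (size X' + size Y')%N; pose B := n`!.
have B0 : (0 < B)%N by exact: fact_gt0.
pose mw p := (\max_(m <- msupp p) wt w0 w1 m)%N.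
have mwP p m : m \in msupp p -> (wt w0 w1 m <= mw p)%N.
  by move=> mp; rewrite /mw (bigD1_seq m) ?msupp_uniq //= leq_maxl.
have mw_max p : (0 < mw p)%N -> exists2 m, m \in msupp p & wt w0 w1 m = mw p.
  rewrite /mw; elim: (msupp p) => [|m s IH]; first by rewrite big_nil.
  rewrite big_cons; case: (leqP (\max_(j <- s) wt w0 w1 j)%N (wt w0 w1 m)) => h.
    by exists m; rewrite ?mem_head.
  by case: IH => [|m' m's e]; [exact: leq_trans h | exists m'; rewrite // in_cons m's orbT].
(* For l > 0 this is the least slope N for which the coefficients of t^l respect the weight bounds.
   N is the maximum, attained at some l0, and there the initial form has a nonzero coefficient: the
   limit family is not the identity. *)
pose F l := ((B %/ l) * maxn (mw (X'`_l)%R - w0) (mw (Y'`_l)%R - w1))%N.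
pose N := (\max_(l < n.+1) F l)%N.
have FN l : (l <= n)%N -> (F l <= N)%N.
  by move=> ln; rewrite /N (bigD1 (inord l)) //= inordK ?ltnS // leq_maxl.
have wtB m : wt (B * w0) (B * w1) m = (B * wt w0 w1 m)%N by rewrite /wt mulnDr !mulnA.
have tleP P (u : nat) : (forall l, (n < l)%N -> P`_l = 0) -> (mw (P`_0)%R <= u)%N ->
    (forall l, (B %/ l * (mw (P`_l)%R - u) <= F l)%N) -> tle (B * w0) (B * w1) N (B * u) P.
  move=> Pn P0 PF l; apply: size_wtwist => m mP; rewrite wtB.
  have lm := mwP _ _ mP; case: (posnP l) => [l0|l0].
    rewrite l0 muln0 addn0 leq_mul2l (leq_trans lm) ?orbT //; by rewrite l0.
  have ln : (l <= n)%N.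
    by rewrite leqNgt; apply/negP => /Pn e; rewrite e msupp0 in mP.
  have lB : B = (B %/ l * l)%N by rewrite divnK // dvdn_fact // l0.
  have h1 : (B * (wt w0 w1 m - u) <= N * l)%N.
    rewrite {1}lB mulnAC leq_mul2r (leq_trans _ (leq_trans (PF l) (FN l ln))) ?orbT //.
    by rewrite leq_mul2l leq_sub2r ?orbT.
  by rewrite -leq_subLR -mulnBr.
have mwX0 : (mw 'X_0%R <= w0)%N.
  by rewrite /mw msuppX big_seq1 /wt !mnm1E /= muln1 muln0 addn0.
have mwX1 : (mw 'X_1%R <= w1)%N.
  by rewrite /mw msuppX big_seq1 /wt !mnm1E /= muln1 muln0.
have tX : tle (B * w0) (B * w1) N (B * w0) X'.
  apply: tleP => [l nl||l]; last by rewrite /F leq_mul2l leq_maxl orbT.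
    by rewrite nth_default // (leq_trans (leq_addr (size Y') _)) // ltnW.
  by rewrite X'E X0 expr0 mulr1.
have tY : tle (B * w0) (B * w1) N (B * w1) Y'.
  apply: tleP => [l nl||l]; last by rewrite /F leq_mul2l leq_maxr orbT.
    by rewrite nth_default // (leq_trans (leq_addl (size X') _)) // ltnW.
  by rewrite Y'E Y0 expr0 mulr1.
have fd' : wle (B * w0) (B * w1) (B * d) f.
  by move=> m /fd; rewrite wtB leq_mul2l => ->; rewrite orbT.
exists (tform (B * w0) (B * w1) N (B * w0) X'), (tform (B * w0) (B * w1) N (B * w1) Y').
split; last first.
  rewrite /fixed -(wform_scale w0 w1 d f B0) -tform_evt // fXY'.
  exact: tform_polyC.
split.
- by rewrite coef_tform muln0 addn0 coef_wtwist X'E X0 expr0 mulr1 wform_X0.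
- by rewrite coef_tform muln0 addn0 coef_wtwist Y'E Y0 expr0 mulr1 wform_X1.
(* The power of x has weight at least w0 (w0 + w1 + 1), which exceeds both weights because w0 > 0;
   this gives N > 0. *)
have big p l : (0 < l)%N -> p != 0 -> (maxn w0 w1 < mw (p * ('X_0 ^+ M) ^+ l)%R)%N.
  move=> l0 p0; have q0 : p * ('X_0 ^+ M) ^+ l != 0.
    by rewrite mulf_neq0 // !expf_neq0 // -msize_poly_eq0 msizeX.
  apply: leq_trans (mwP _ _ (mlead_supp q0)).
  rewrite mleadM // ?expf_neq0 // -?msize_poly_eq0 ?msizeX //.
  rewrite -exprM mpolyXn mleadXm /wt !mnmDE !mulmnE !mnm1E /= /M.
  nia.
have [l1 l10 nz] := deformation_coef dXY.
have l1n : (l1 <= n)%N.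
  apply: contraLR nz; rewrite -ltnNge => h; rewrite negb_or !negbK.
  have e : X'`_l1 = 0 /\ Y'`_l1 = 0.
    split; apply: nth_default; apply: ltnW; apply: leq_ltn_trans h.
      exact: leq_addr.
    exact: leq_addl.
  have v0 : ('X_0 ^+ M) ^+ l1 != 0 :> R2 by rewrite !expf_neq0 // -msize_poly_eq0 msizeX.
  by case: e; rewrite X'E Y'E => /eqP; rewrite mulf_eq0 (negPf v0) orbF => -> /eqP;
    rewrite mulf_eq0 (negPf v0) orbF.
have N0 : (0 < N)%N.
  apply: leq_trans (FN l1 l1n); rewrite muln_gt0 divn_gt0 // dvdn_leq ?dvdn_fact ?l10 //=.
  rewrite leq_max !subn_gt0 X'E Y'E.
  case/orP: nz => /(big _ _ l10); rewrite gtn_max => /andP[h1 h2];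
  by rewrite ?h1 ?h2 ?orbT.
have n0 : (0 < #|'I_n.+1|)%N by rewrite card_ord.
have [[l0 l0n] /= Nl0] := eq_bigmax (fun l : 'I_n.+1 => F l) n0.
rewrite -/N in Nl0 => -[eX eY].
(* Division by 0 yields 0, so F 0 = 0 < N and the maximum is attained at a positive index. *)
have l00 : (0 < l0)%N by case: posnP Nl0 => // ->; rewrite /F divn0 mul0n => e; rewrite e in N0.
have lB : B = (B %/ l0 * l0)%N by rewrite divnK // dvdn_fact // l00.
have absurd P u : (B %/ l0 * (mw (P`_l0)%R - u))%N = N ->
    (tform (B * w0) (B * w1) N (B * u) P)`_l0 = 0 -> False.
  move=> eN; have : (0 < mw (P`_l0)%R - u)%N.
    by move: N0; rewrite -eN muln_gt0 => /andP[].
  rewrite subn_gt0 => h; have [|m mP me] := mw_max (P`_l0); first exact: leq_ltn_trans h.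
  rewrite coef_tform coef_wtwist => /(congr1 (mcoeff m)).
  rewrite mcoeff_wform wtB me mcoeff0.
  have -> : (B * u + N * l0 = B * mw (P`_l0)%R)%N.
    by rewrite -eN mulnAC -lB -mulnDr subnKC // ltnW.
  by rewrite eqxx => /eqP; rewrite mcoeff_eq0 mP.
have zc (v : R2) : (v%:P)`_l0 = 0 by rewrite coefC (gtn_eqF l00).
case: (leqP (mw (X'`_l0)%R - w0) (mw (Y'`_l0)%R - w1)) => h.
  by apply: (absurd Y' w1); rewrite ?eY // Nl0 /F (maxn_idPr h).
by apply: (absurd X' w0); rewrite ?eX // Nl0 /F (maxn_idPl (ltnW h)).
Qed.

End Degeneration.

(** * Leading forms fixed by a deformation *)

Definition mnm2 (i j : nat) : 'X_{1..2} := [multinom if l == 0%R then i else j | l < 2].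

Lemma mnm2_0 i j : mnm2 i j 0 = i. Proof. by rewrite mnmE. Qed.
Lemma mnm2_1 i j : mnm2 i j 1 = j. Proof. by rewrite mnmE. Qed.

Lemma mnm2_eq (m m' : 'X_{1..2}) : m 0 = m' 0 -> m 1 = m' 1 -> m = m'.
Proof. by move=> e0 e1; apply/mnmP => l; case: (ord2_cases l) => ->. Qed.

Lemma mdeg2 (m : 'X_{1..2}) : mdeg m = (m 0%R + m 1%R)%N.
Proof. by rewrite mdegE big_ord2. Qed.

Lemma mpolyX2 (R : comNzRingType) (m : 'X_{1..2}) :
  'X_[m] = 'X_0 ^+ m 0 * 'X_1 ^+ m 1 :> {mpoly R[2]}.
Proof. by rewrite [LHS]mpolyXE_id big_ord2. Qed.

(** Homogenization of a split polynomial: formally, its value at V / U multiplied by U to the number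
    of roots. *)
Lemma homog_prodXsubC (K : comNzRingType) (A : comAlgType K) (r : seq K) (U V : A) :
  \sum_(l < (size r).+1) (\prod_(z <- r) ('X - z%:P))`_l *: (U ^+ (size r - l) * V ^+ l)
  = \prod_(z <- r) (V - z *: U).
Proof.
elim: r => [|z r IH].
  by rewrite big_ord_recl big_ord0 addr0 !big_nil coef1 scale1r !expr0 mulr1.
rewrite !big_cons -IH [RHS]mulrBl; set h := \prod_(_ <- r) _.
rewrite [('X - _) * _]mulrBl; under eq_bigr do rewrite coefB coefXM coefCM scalerBl.
rewrite sumrB; congr (_ - _).
  rewrite big_ord_recl /= scale0r add0r mulr_sumr; apply: eq_bigr => i _ /=.
  by rewrite -scalerAr exprS subSS; congr (_ *: _); rewrite mulrCA.
rewrite big_ord_recr /= [h`__]nth_default ?size_prod_XsubC // mulr0 scale0r addr0.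
rewrite mulr_sumr; apply: eq_bigr => i _ /=.
rewrite subSn; last by rewrite -ltnS.
by rewrite exprS -!mulrA -scalerAl -scalerAr scalerA.
Qed.

Section Forms.
Variable K : closedFieldType.
Local Notation R2 := {mpoly K[2]}.
Implicit Types (f : R2).

Lemma var_neq0 i : 'X_i != 0 :> R2.
Proof. by rewrite -msize_poly_eq0 msizeX. Qed.

(** Splitting [h] makes f a scalar times a power of x times a product of factors y^p - z x^q, all of
    them fixed by the deformation. Two different values of z, or a factor x, would make x^q fixed,
    then y^p, and so both variables. Hence one z only and no power of x. If z were 0, [h] would
    vanish at 0. *)
Lemma stabilized_form f (p q k : nat) (h : {poly K}) :
  (0 < p)%N -> (0 < q)%N -> (1 < size h)%N -> (q * (size h).-1 <= k)%N ->
  f = \sum_(l < size h) h`_l *: ('X_0 ^+ (k - q * l) * 'X_1 ^+ (p * l)) ->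
  stabilized f ->
  exists z c, [/\ c != 0, k = (q * (size h).-1)%N,
    f = c *: ('X_1 ^+ p - z *: 'X_0 ^+ q) ^+ (size h).-1,
    h`_0 != 0 -> z != 0 &
    stabilized ('X_1 ^+ p - z *: 'X_0 ^+ q)].
Proof.
move=> p0 q0 sh kq fE [X [Y [dXY fXY]]].
have [r hr] := closed_field_poly_normal h.
have h0 : h != 0 by rewrite -size_poly_gt0 ltnW.
have c0 : lead_coef h != 0 by rewrite lead_coef_eq0.
have sr : size h = (size r).+1 by rewrite hr size_scale // size_prod_XsubC.
set c := lead_coef h in hr c0.
rewrite sr /= in sh kq *.
pose U : R2 := 'X_0 ^+ q; pose V : R2 := 'X_1 ^+ p.
pose B z : R2 := V - z *: U.
have fP : f = 'X_0 ^+ (k - q * size r) * (c *: \prod_(z <- r) B z).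
  rewrite fE sr -homog_prodXsubC scaler_sumr mulr_sumr; apply: eq_bigr => l _.
  have lL : (l <= size r)%N by rewrite -ltnS.
  have e : (k - q * l = k - q * size r + q * (size r - l))%N.
    have : (q * l <= q * size r)%N by rewrite leq_mul2l lL orbT.
    rewrite mulnBr; move: (q * l)%N (q * size r)%N kq => u v; lia.
  by rewrite {1}hr coefZ -scalerA -!scalerAr /U /V -!exprM mulrA -exprD -e.
have B0 z : B z != 0.
  apply/eqP => /(congr1 (mcoeff (U_(1) *+ p)%MM)).
  rewrite mcoeffB mcoeffZ /U /V !mpolyXn !mcoeffX eqxx mcoeff0.
  case: eqP => [/(congr1 (fun m : 'X_{1..2} => m 1))|_].
    rewrite /= !mulmnE !mnm1E /= mul0n mul1n => e; by rewrite -e in p0.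
  by rewrite mulr0 subr0 => /eqP; rewrite oner_eq0.
have prod0 (s : seq K) : \prod_(z <- s) B z != 0 by rewrite prodf_seq_neq0; apply/allP => z _; exact: B0.
have Xn0 j : ('X_0 : R2) ^+ j != 0 by rewrite expf_neq0 // var_neq0.
have f0 : f != 0 by rewrite fP mulf_neq0 // scaler_eq0 (negPf c0) (prod0 r).
have fixP : fixed X Y (\prod_(z <- r) B z).
  apply: (fixedZ_inv c0); rewrite fP mulrC in fXY f0; exact: fixed_factor f0 fXY.
have fixB z : z \in r -> fixed X Y (B z).
  move=> zr; have e : \prod_(y <- r) B y = B z * \prod_(y <- rem z r) B y.
    exact: big_rem.
  have := prod0 r; move: fixP; rewrite e => h1 h2; exact: fixed_factor h2 h1.
case: r hr sr kq fP prod0 fixP fixB sh => [//|z r] hr sr kq fP _ fixP fixB sh.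
have fz : fixed X Y (B z) by apply: fixB; rewrite mem_head.
have nU : ~ fixed X Y U.
  move=> fU; apply: (not_both_fixed dXY).
    by apply: (fixed_exp (n := q.-1) dXY (var_neq0 _)); rewrite prednK.
  have fV : fixed X Y V by rewrite -[V](subrK (z *: U)); apply: fixedD => //; apply: fixedZ.
  by apply: (fixed_exp (n := p.-1) dXY (var_neq0 _)); rewrite prednK.
have kE : k = (q * size (z :: r))%N.
  apply/eqP; rewrite eqn_leq kq andbT -subn_eq0; apply/negPn/negP; rewrite -lt0n => kL.
  apply: nU; rewrite /U /fixed.
  suff fx : fixed X Y 'X_0 by rewrite rmorphXn /= fx rmorphXn.
  move: fXY f0; rewrite fP; case: (k - _)%N kL => // j _; rewrite exprS -mulrA => fXY f0.
  exact: fixed_factor f0 fXY.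
have allz : {in r, forall z', z' = z}.
  move=> z' z'r; apply/eqP/negPn/negP => zz; apply: nU.
  have fz' : fixed X Y (B z') by apply: fixB; rewrite in_cons z'r orbT.
  have zz0 : z - z' != 0 by rewrite subr_eq0 eq_sym.
  apply: (fixedZ_inv zz0); have -> : (z - z') *: U = B z' + (-1) *: B z.
    by rewrite /B scaleN1r opprB [RHS]addrC addrA subrK scalerBl.
  by apply: fixedD => //; apply: fixedZ.
exists z, c; split=> //.
- rewrite fP kE subnn expr0 mul1r; congr (_ *: _).
  rewrite exprS big_cons; congr (_ * _).
  rewrite (eq_big_seq (fun=> B z)) => [|z' /allz -> //].
  by rewrite big_const_seq count_predT iter_mulr mulr1.
- apply: contraNneq => z0; rewrite hr coefZ big_cons z0 subr0 coefXM /=.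
  by rewrite mulr0.
- by exists X, Y.
Qed.

End Forms.

Lemma sum_coef_widen (R : nzRingType) (V : lmodType R) (h : {poly R}) (F : nat -> V) n :
  (size h <= n)%N -> \sum_(l < size h) h`_l *: F l = \sum_(l < n) h`_l *: F l.
Proof.
move=> hn; rewrite (big_ord_widen n (fun l => h`_l *: F l)) // big_mkcond /=.
by apply: eq_bigr => l _; case: ltnP => // /(nth_default 0) ->; rewrite scale0r.
Qed.

(** The ratios a / b are compared by cross-multiplication. The minimum is the slope of a Newton
    polygon edge; with b = 1 it is an ordinary minimum. *)
Lemma min_ratio (T : eqType) (a b : T -> nat) (s : seq T) : s != [::] ->
  (forall x, x \in s -> 0 < b x)%N ->
  exists2 x, x \in s & forall y, y \in s -> (a x * b y <= a y * b x)%N.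
Proof.
elim: s => [//|x s IH] _ bs; have [->|s0] := eqVneq s [::].
  by exists x; rewrite ?mem_head // => y; rewrite inE => /eqP ->.
have [|x' x's x'min] := IH s0; first by move=> y ys; apply: bs; rewrite in_cons ys orbT.
have bx : (0 < b x)%N by apply: bs; rewrite mem_head.
have bx' : (0 < b x')%N by apply: bs; rewrite in_cons x's orbT.
have [h|h] := leqP (a x * b x') (a x' * b x).
  exists x => [|y]; first exact: mem_head.
  rewrite in_cons => /orP[/eqP -> //|ys]; have := x'min _ ys.
  move=> h2; have := leq_mul h2 (leqnn (b x)); have := leq_mul h (leqnn (b y)).
  by move=> h3 h4; rewrite -(leq_pmul2l bx'); lia.
exists x' => [|y]; first by rewrite in_cons x's orbT.
by rewrite in_cons => /orP[/eqP ->|/x'min //]; exact: ltnW.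
Qed.

(** * Edges of the Newton polygon *)

Section NewtonEdge.
Variable K : closedFieldType.
Local Notation R2 := {mpoly K[2]}.
Implicit Types (f : R2).

(** Since p and q are coprime, p i + q j = p k forces p to divide j, say j = p l, and then i = k - q
    l. The test q l <= k keeps truncated subtraction from adding spurious monomials. *)
Lemma wform_sum f (p q k : nat) : (0 < p)%N -> (0 < q)%N -> coprime p q ->
  wform p q (p * k)%N f = \sum_(l < k.+1)
    (if (q * l <= k)%N then f@_(mnm2 (k - q * l) (p * l)) else 0) *:
    ('X_0 ^+ (k - q * l) * 'X_1 ^+ (p * l)).
Proof.
move=> p0 q0 cpq; apply/mpolyP => m; rewrite mcoeff_wform [RHS]raddf_sum /=.
have coefE (l : 'I_k.+1) c i j : (c *: ('X_0 ^+ i * 'X_1 ^+ j : R2))@_m = c * (mnm2 i j == m)%:R.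
  by rewrite mcoeffZ -mcoeffX [in RHS]mpolyX2 mnm2_0 mnm2_1.
rewrite (eq_bigr _ (fun l _ => coefE l _ _ _)).
case: eqP => [mk|mk]; last first.
  rewrite big1 // => l _; case: leqP => ql; last by rewrite mul0r.
  case: eqP => [e|]; last by rewrite mulr0.
  case: mk; rewrite /wt -e mnm2_0 mnm2_1 mulnBr mulnCA subnK // -mulnCA.
  by rewrite leq_mul2l ql orbT.
have pm1 : (p %| m 1%R)%N.
  rewrite -(Gauss_dvdr _ cpq) -(dvdn_addr _ (dvdn_mulr (m 0%R) (dvdnn p))).
  by rewrite -/(wt p q m) mk dvdn_mulr.
have [l lE] : exists l, m 1%R = (p * l)%N by case/dvdnP: pm1 => l ->; exists l; rewrite mulnC.
have kE : (m 0%R + q * l = k)%N.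
  by apply/eqP; rewrite -(eqn_pmul2l p0) -mk /wt lE mulnDr mulnCA.
have qlk : (q * l <= k)%N by rewrite -kE leq_addl.
have lk : (l < k.+1)%N by rewrite ltnS (leq_trans _ qlk) // leq_pmull.
have mE : m = mnm2 (k - q * l) (p * l).
  by apply: mnm2_eq; rewrite ?mnm2_0 ?mnm2_1 // -kE addnK.
rewrite (bigD1 (Ordinal lk)) //= qlk -mE eqxx mulr1 big1 ?addr0 // => i il.
case: eqP => [e|]; last by rewrite mulr0.
case/eqP: il; apply/val_inj/eqP; rewrite /= -(eqn_pmul2l p0); apply/eqP.
by have := congr1 (fun m : 'X_{1..2} => m 1) e; rewrite /= mnm2_1 lE.
Qed.

(** The alternatives are an edge polynomial [h] that is constant or not. The second one hands on the
    stabilized factor and a criterion for z != 0, so that [cusp_not_fixed] can be applied to it. *)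
Lemma stabilized_wform_cases f (p q k : nat) :
  (0 < p)%N -> (0 < q)%N -> coprime p q -> wle p q (p * k)%N f -> stabilized f ->
  wform p q (p * k)%N f != 0 ->
  (exists2 c, c != 0 & wform p q (p * k)%N f = c *: 'X_0 ^+ k) \/
  (exists L z c, [/\ (0 < L)%N /\ c != 0, k = (q * L)%N,
     wform p q (p * k)%N f = c *: ('X_1 ^+ p - z *: 'X_0 ^+ q) ^+ L,
     f@_(mnm2 k 0) != 0 -> z != 0 & stabilized ('X_1 ^+ p - z *: 'X_0 ^+ q)]).
Proof.
move=> p0 q0 cpq fk sf; have sg := stabilized_wform p0 fk sf.
have gE := wform_sum f k p0 q0 cpq; move: (wform _ _ _ _) sg gE => g sg gE g0.
pose E (l : nat) := (if (q * l <= k)%N then f@_(mnm2 (k - q * l) (p * l)) else 0).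
pose F (l : nat) : R2 := 'X_0 ^+ (k - q * l) * 'X_1 ^+ (p * l).
pose h := \poly_(l < k.+1) E l.
have gh : g = \sum_(l < size h) h`_l *: F l.
  rewrite (@sum_coef_widen _ _ _ _ k.+1) ?size_poly // gE.
  by apply: eq_bigr => l _; rewrite coef_poly ltn_ord.
have h0 : h != 0.
  by apply: contraNneq g0 => hz; rewrite gh hz size_poly0 big_ord0.
have hcoef l : h`_l != 0 -> (q * l <= k)%N /\ h`_l = E l.
  by rewrite coef_poly; case: ltnP => _; rewrite ?eqxx // /E; case: leqP; rewrite ?eqxx.
have [qL _] : (q * (size h).-1 <= k)%N /\ h`_(size h).-1 = E (size h).-1.
  by apply: hcoef; rewrite -/(lead_coef h) lead_coef_eq0.
have [sh|sh] := leqP (size h) 1.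
  left; move: h0 gh; rewrite (size1_polyC sh) polyC_eq0 => h00; rewrite size_polyC h00.
  rewrite big_ord_recl big_ord0 addr0 coefC /= /F !muln0 subn0 expr0 mulr1 => ->.
  by exists h`_0.
right; have [z [c [c0 kE gE' z0 sB]]] := stabilized_form p0 q0 sh qL gh sg.
exists (size h).-1, z, c; split=> //.
  by split=> //; rewrite -subn1 subn_gt0.
move=> fk0; apply: z0; rewrite coef_poly /= /E !muln0 subn0.
exact: fk0.
Qed.

End NewtonEdge.

(** * Weighted degree, total degree and substitution *)

Section WeightBounds.
Variables (K : fieldType) (u v : nat).
Local Notation R2 := {mpoly K[2]}.
Implicit Types (p q a b : R2).

Lemma wtD m m' : wt u v (m + m')%MM = (wt u v m + wt u v m')%N.
Proof. by rewrite /wt !mnmDE; ring. Qed.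

Lemma wleW d e p : (d <= e)%N -> wle u v d p -> wle u v e p.
Proof. by move=> de pd m /pd h; apply: leq_trans h de. Qed.

Lemma wleC c d : wle u v d (c%:MP : R2).
Proof.
move=> m; rewrite msuppC; case: ifP => // _; rewrite inE => /eqP ->.
by rewrite /wt !mnm0E !muln0.
Qed.

Lemma wle0 d : wle u v d (0 : R2).
Proof. by move=> m; rewrite -mpolyC0 msupp0. Qed.

Lemma wleD d p q : wle u v d p -> wle u v d q -> wle u v d (p + q).
Proof. by move=> pd qd m /msuppD_le; rewrite mem_cat => /orP[/pd|/qd]. Qed.

Lemma wleZ d c p : wle u v d p -> wle u v d (c *: p).
Proof. by move=> pd m /msuppZ_le /pd. Qed.

Lemma wleN d p : wle u v d p -> wle u v d (- p).
Proof. by rewrite -scaleN1r; exact: wleZ. Qed.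

Lemma wleB d p q : wle u v d p -> wle u v d q -> wle u v d (p - q).
Proof. by move=> pd qd; apply: wleD => //; apply: wleN. Qed.

Lemma wleM d e p q : wle u v d p -> wle u v e q -> wle u v (d + e)%N (p * q).
Proof.
move=> pd qe m /msuppM_le /allpairsP [[m1 m2] /= [m1p m2q ->]].
by rewrite wtD leq_add ?pd ?qe.
Qed.

Lemma wleX d p n : wle u v d p -> wle u v (d * n)%N (p ^+ n).
Proof.
move=> pd; elim: n => [|n IH]; first by rewrite expr0 muln0; exact: wleC.
by rewrite exprS mulnS; apply: wleM.
Qed.

Lemma wle_sum (I : Type) (r : seq I) d (F : I -> R2) :
  (forall i, wle u v d (F i)) -> wle u v d (\sum_(i <- r) F i).
Proof.
by move=> Fd; elim/big_rec: _ => [|i p _ pd]; [exact: wle0 | exact: wleD].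
Qed.

Lemma wle_X0 : wle u v u ('X_0 : R2).
Proof. by move=> m /mem_msuppXP <-; rewrite /wt !mnm1E /= muln1 muln0 addn0. Qed.

Lemma wle_X1 : wle u v v ('X_1 : R2).
Proof. by move=> m /mem_msuppXP <-; rewrite /wt !mnm1E /= muln1 muln0. Qed.

Lemma wle_sub2 d0 d1 d a b p : wle u v d0 a -> wle u v d1 b -> wle d0 d1 d p ->
  wle u v d (sub2 a b p).
Proof.
move=> ad bd pd; rewrite sub2E big_seq.
elim/big_rec: _ => [|m q mp qd]; first exact: wle0.
apply: wleD => //; apply: wleZ; apply: wleW (pd m mp) _.
by apply: wleM; apply: wleX.
Qed.

Lemma tle_polyC d p : wle u v d p -> tle u v 0 d p%:P.
Proof.
move=> pd l; rewrite mul0n addn0 coefC; case: eqP => _; first exact: size_wtwist.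
by rewrite wtwist0 size_poly0.
Qed.

(** The case of [tform_evt] in which X and Y are constant in t and N = 0. *)
Lemma wform_sub2 d a b p : wle u v u a -> wle u v v b -> wle u v d p ->
  wform u v d (sub2 a b p) = sub2 (wform u v u a) (wform u v v b) (wform u v d p).
Proof.
move=> ad bd pd; apply: polyC_inj; rewrite -(tform_polyC u v 0) -evt_polyC.
by rewrite tform_evt ?tform_polyC -?evt_polyC //; exact: tle_polyC.
Qed.

Lemma wformD d p q : wform u v d (p + q) = wform u v d p + wform u v d q.
Proof.
by apply/mpolyP => m; rewrite mcoeffD !mcoeff_wform mcoeffD; case: eqP; rewrite ?addr0.
Qed.

Lemma wformZ d c p : wform u v d (c *: p) = c *: wform u v d p.
Proof.
by apply/mpolyP => m; rewrite mcoeffZ !mcoeff_wform mcoeffZ; case: eqP; rewrite ?mulr0.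
Qed.

Lemma wform_id d p : (forall m, m \in msupp p -> wt u v m = d) -> wform u v d p = p.
Proof.
move=> pd; apply/mpolyP => m; rewrite mcoeff_wform; case: eqP => // md.
by apply/esym/memN_msupp_eq0; apply/negP => /pd.
Qed.

End WeightBounds.

Section TotalDegree.
Variable K : closedFieldType.
Local Notation R2 := {mpoly K[2]}.
Implicit Types (p q a b f : R2) (P Q : {poly K}).

Lemma wt11 m : wt 1 1 m = mdeg m.
Proof. by rewrite /wt !mul1n mdeg2. Qed.

Lemma total_degP p d : (total_deg p <= d)%N <-> wle 1 1 d p.
Proof.
rewrite /total_deg; split=> [pd m mp | pd].
  rewrite wt11 (leq_trans _ pd) // -ltnS (leq_trans (msize_mdeg_lt mp)) //.
  exact: leqSpred.
have [->|p0] := eqVneq p 0; first by rewrite mmeasure0.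
by have := pd _ (mlead_supp p0); rewrite wt11 -(mlead_deg p0).
Qed.

Lemma total_degC c : total_deg (c%:MP : R2) = 0%N.
Proof. by apply/eqP; rewrite -leqn0; apply/total_degP; exact: wleC. Qed.

Lemma total_degM p q : p != 0 -> q != 0 ->
  total_deg (p * q) = (total_deg p + total_deg q)%N.
Proof.
move=> p0 q0; rewrite /total_deg msizeM // (mpolySpred _ p0) (mpolySpred _ q0).
by rewrite addSn addnS.
Qed.

Lemma total_degDC p c : total_deg (p + c%:MP) = total_deg p.
Proof.
have le q e : (total_deg (q + e%:MP) <= total_deg q)%N.
  by apply/total_degP/wleD; [apply/total_degP | exact: wleC].
apply/eqP; rewrite eqn_leq le /=.
by have := le (p + c%:MP) (- c); rewrite mpolyCN addrK.
Qed.

Lemma total_deg0 p : total_deg p = 0%N -> exists c, p = c%:MP.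
Proof.
move=> p0; exists (p@_0%MM); apply: msize1_polyC; apply: leq_trans (leqSpred _) _.
by rewrite -/(total_deg p) p0.
Qed.

Lemma total_deg_sub2 d e p a b : (total_deg a <= e)%N -> (total_deg b <= e)%N ->
  (total_deg p <= d)%N -> (total_deg (sub2 a b p) <= e * d)%N.
Proof.
move=> /total_degP ae /total_degP be /total_degP pd; apply/total_degP.
apply: (wle_sub2 ae be) => m /pd; rewrite /wt !mul1n -mulnDr => h.
by rewrite leq_mul2l h orbT.
Qed.

Definition peval P a : R2 := (map_poly (@mpolyC 2 K) P).[a].

Lemma pevalD P Q a : peval (P + Q) a = peval P a + peval Q a.
Proof. by rewrite /peval rmorphD hornerD. Qed.

Lemma pevalB P Q a : peval (P - Q) a = peval P a - peval Q a.
Proof. by rewrite /peval rmorphB hornerD hornerN. Qed.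

Lemma pevalE P a : peval P a = \sum_(l < size P) P`_l *: a ^+ l.
Proof.
rewrite /peval horner_coef size_map_inj_poly ?mpolyC0 //; last exact: (can_inj (@mpolyCK _ _)).
by apply: eq_bigr => l _; rewrite coef_map mul_mpolyC.
Qed.

Lemma pevalZXn c n a : peval (c *: 'X^n) a = c *: a ^+ n.
Proof. by rewrite /peval map_polyZ map_polyXn hornerZ hornerXn mul_mpolyC. Qed.

Lemma sub2_peval a b P p : sub2 a b (peval P p) = peval P (sub2 a b p).
Proof.
rewrite !pevalE rmorph_sum; apply: eq_bigr => l _ /=.
by rewrite sub2Z rmorphXn.
Qed.

Lemma pevalC c a : peval c%:P a = c%:MP.
Proof. by rewrite /peval map_polyC hornerC. Qed.

Lemma peval_MXaddC P c a : peval (P * 'X + c%:P) a = peval P a * a + c%:MP.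
Proof. by rewrite pevalD pevalC /peval rmorphM /= map_polyX hornerMX. Qed.

Lemma total_deg_peval P a : total_deg (peval P a) = ((size P).-1 * total_deg a)%N.
Proof.
case: (posnP (total_deg a)) => [a0|a0].
  have [c ->] := total_deg0 a0.
  by rewrite /peval horner_map /= !total_degC muln0.
have an0 : a != 0 by apply: contraTneq a0 => ->; rewrite /total_deg mmeasure0.
elim/poly_ind: P => [|P c IH]; first by rewrite pevalE size_poly0 big_ord0 /total_deg mmeasure0.
rewrite peval_MXaddC total_degDC size_MXaddC.
have [->|P0] := eqVneq P 0.
  by rewrite pevalE size_poly0 big_ord0 mul0r /total_deg mmeasure0; case: eqP.
have Pa0 : peval P a != 0.
  apply/eqP => Pa0; move: IH; rewrite Pa0 /total_deg mmeasure0 -/(total_deg a) => /esym/eqP.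
  rewrite muln_eq0 (gtn_eqF a0) orbF -subn1 subn_eq0 => /size1_polyC eP.
  move: Pa0 P0; rewrite eP pevalC polyC_eq0 => /eqP; rewrite mpolyC_eq0 => /eqP ->.
  by rewrite eqxx.
rewrite total_degM //= IH; case: (size P) (size_poly_gt0 P) => [|n] /=; last by rewrite mulSn addnC.
by rewrite P0.
Qed.

End TotalDegree.

(** * Reduction of the degree *)

Section Reduction.
Variable K : closedFieldType.
Local Notation R2 := {mpoly K[2]}.
Implicit Types (f g : R2) (P Q : {poly K}).

(** The family is the translation of g by t read through the inverse: X = F(f, g + t), Y = G(f, g +
    t). It fixes f because f(F, G) = x, and it moves g to g + t, so it is not the identity. *)
Lemma autpair_stabilized f g : autpair f g -> stabilized f.
Proof.
move=> [F [G [FE GE fE gE]]].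
pose T : {poly R2} := g%:P + 'X.
have T0 : T`_0 = g by rewrite coefD coefC coefX addr0.
exists (evt f%:P T F), (evt f%:P T G); split; last first.
  by rewrite /fixed -evt_sub2 fE evt_X0.
split; rewrite ?evt_coef0 ?T0 ?coefC //= => -[eX eY].
have : evt (evt f%:P T F) (evt f%:P T G) g = T by rewrite -evt_sub2 gE evt_X1.
rewrite eX eY evt_polyC sub2_id => /(congr1 (fun A : {poly R2} => A`_1)).
by rewrite coefD !coefC coefX /= add0r => /eqP; rewrite eq_sym oner_eq0.
Qed.

Lemma sum_mcoeff_delta f (m' : 'X_{1..2}) :
  \sum_(m <- msupp f) f@_m * (m == m')%:R = f@_m'.
Proof.
have [mp|mp] := boolP (m' \in msupp f); last first.
  rewrite (memN_msupp_eq0 mp) big1_seq // => m /andP[_ mf]; case: eqP => [e|]; last by rewrite mulr0.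
  by rewrite -e mf in mp.
rewrite (bigD1_seq m') ?msupp_uniq //= eqxx mulr1 big1 ?addr0 // => m /negPf ->.
by rewrite mulr0.
Qed.

Lemma coef_xrest f j : (bieval (@polyC K) 'X 0 f)`_j = f@_(mnm2 j 0).
Proof.
rewrite bievalE coef_sum -sum_mcoeff_delta; apply: eq_bigr => m _.
rewrite coefCM; congr (_ * _); rewrite expr0n.
case: eqP => [m1|m1]; rewrite ?mulr1 ?mulr0 ?coefXn ?coef0.
  congr (_%:R); congr (nat_of_bool _); apply/eqP/eqP => [->|->]; last by rewrite mnm2_0.
  by apply: mnm2_eq; rewrite ?mnm2_0 ?mnm2_1.
by case: eqP => // e; case: m1; rewrite e mnm2_1.
Qed.

(** The restriction f(0, y). Shears y + z x^n with n > 0 leave it unchanged, so its degree is known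
    beforehand as the degree where the reduction stops. *)
Definition yrest f : {poly K} := bieval (@polyC K) 0 'X f.

Lemma coef_yrest f j : (yrest f)`_j = f@_(mnm2 0 j).
Proof.
rewrite /yrest bievalE coef_sum -sum_mcoeff_delta; apply: eq_bigr => m _.
rewrite coefCM; congr (_ * _); rewrite expr0n.
case: eqP => [m0|m0]; rewrite ?mul1r ?mul0r ?coefXn ?coef0.
  congr (_%:R); congr (nat_of_bool _); apply/eqP/eqP => [->|->]; last by rewrite mnm2_1.
  by apply: mnm2_eq; rewrite ?mnm2_0 ?mnm2_1.
by case: eqP => // e; case: m0; rewrite e mnm2_0.
Qed.

Lemma yrest_sub2 z n f : (0 < n)%N ->
  yrest (sub2 'X_0 ('X_1 + z *: 'X_0 ^+ n) f) = yrest f.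
Proof.
move=> n0; rewrite /yrest bieval_sub2 rmorphD /= bievalZ rmorphXn /= bieval_X0 bieval_X1.
by rewrite expr0n (gtn_eqF n0) mulr0 addr0.
Qed.

(** If y did not occur, f would be h(x), and h(F) = x would force h to have degree 1. *)
Lemma autpair_mem_y f g : autpair f g -> (1 < total_deg f)%N ->
  exists2 m, m \in msupp f & (0 < m 1%R)%N.
Proof.
move=> [F [G [_ _ fE _]]] f1; apply: contrapT => h.
have f0 (a b : R2) : sub2 a b f = sub2 a 0 f.
  rewrite !sub2E; apply: eq_big_seq => m mf; case: (posnP (m 1)) => [e|m1]; last by case: h; exists m.
  by rewrite e !expr0.
pose h0 : {poly K} := bieval (@polyC K) 'X 0 f.
have pE (a : R2) : sub2 a 0 f = peval h0 a.
  have e := @bieval_comp K _ _ (@polyC K) (@mpolyC 2 K)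
    (horner_eval a \o map_poly (@mpolyC 2 K)) 'X 0 f.
  rewrite sub2_bieval /peval -/(horner_eval a _); rewrite /= in e.
  rewrite e => [|c]; last by rewrite map_polyC /horner_eval hornerC.
  by rewrite map_polyX rmorph0 /horner_eval hornerX horner0.
have d1 : total_deg ('X_0 : R2) = 1%N by rewrite /total_deg msizeX mdeg1.
have := sub2_id f; rewrite f0 pE => /(congr1 (@total_deg K)).
rewrite total_deg_peval d1 muln1 => hf.
have := fE; rewrite f0 pE => /(congr1 (@total_deg K)).
rewrite total_deg_peval d1 hf => /eqP; rewrite muln_eq1 => /andP[/eqP e _].
by rewrite e in f1.
Qed.

(** The edge leaving x^k is found by minimizing (k - i) / j over the monomials x^i y^j of f with j >
    0; the minimum is q / p in lowest terms. As the leading form is c x^k, those monomials have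
    degree below k, so p < q. The coefficient c makes z nonzero, and p > 1 would contradict
    [cusp_not_fixed]; hence p = 1. *)
Lemma newton_edge f k c : stabilized f -> wle 1 1 k f -> c != 0 ->
  wform 1 1 k f = c *: 'X_0 ^+ k -> (exists2 m, m \in msupp f & (0 < m 1%R)%N) ->
  exists (q L : nat) (z c' : K), [/\ (1 < q)%N /\ (0 < L)%N, k = (q * L)%N, c' != 0,
    wle 1 q k f & wform 1 q k f = c' *: ('X_1 - z *: 'X_0 ^+ q) ^+ L].
Proof.
move=> sf fk c0 ftop [m1 m1f m1y].
pose s := [seq m : 'X_{1..2} <- msupp f | (0 < m 1%R)%N].
pose a (m : 'X_{1..2}) : nat := (k - m 0%R)%N; pose b (m : 'X_{1..2}) : nat := m 1%R.
have s0 : s != [::].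
  by rewrite -has_filter; apply/hasP; exists m1.
have [|ms] := @min_ratio _ a b s s0; first by move=> m; rewrite mem_filter => /andP[].
rewrite mem_filter => /andP[msy msf] msmin.
have mk m : m \in msupp f -> (m 0%R + m 1%R <= k)%N.
  by move=> /fk; rewrite wt11 mdeg2.
have xk (m : 'X_{1..2}) n : (0 < m 1%R)%N -> ('X_0 ^+ n : R2)@_m = 0.
  move=> my; rewrite mpolyXn mcoeffX; case: eqP => // e; move: my; rewrite -e.
  by rewrite mulmnE mnm1E.
have mslt : (ms 0%R + ms 1%R < k)%N.
  rewrite ltn_neqAle mk // andbT; apply/eqP => e.
  have := mcoeff_wform 1 1 k f ms; rewrite ftop wt11 mdeg2 e eqxx mcoeffZ xk // mulr0.
  by move/esym/eqP; rewrite mcoeff_eq0 msf.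
have bms : (0 < b ms)%N by [].
have ba : (b ms < a ms)%N by rewrite /a /b; lia.
pose d := gcdn (b ms) (a ms).
have d0 : (0 < d)%N by rewrite gcdn_gt0 bms.
have [p pE] : exists p, b ms = (p * d)%N by apply/dvdnP; exact: dvdn_gcdl.
have [q qE] : exists q, a ms = (q * d)%N by apply/dvdnP; exact: dvdn_gcdr.
have pq : (p < q)%N by move: ba; rewrite pE qE ltn_pmul2r.
have p0 : (0 < p)%N by move: bms; rewrite pE muln_gt0 => /andP[].
have q0 : (0 < q)%N by apply: leq_ltn_trans pq.
have cpq : coprime p q.
  rewrite /coprime -(eqn_pmul2r d0) mul1n muln_gcdl -pE -qE.
  by rewrite /d.
have wd m : (wt p q m * d = b ms * m 0%R + a ms * m 1%R)%N.
  by rewrite pE qE /wt; ring.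
have fpq : wle p q (p * k)%N f.
  move=> m mf; rewrite -(leq_pmul2r d0) wd mulnAC -pE.
  have mk' := mk _ mf.
  have -> : k = (m 0%R + a m)%N by rewrite subnKC // (leq_trans _ mk') // leq_addr.
  rewrite mulnDr leq_add2l; case: (posnP (m 1)) => [->|my]; first by rewrite muln0.
  by rewrite [(b ms * _)%N]mulnC; apply: msmin; rewrite mem_filter my.
have wms : wt p q ms = (p * k)%N.
  apply/eqP; rewrite -(eqn_pmul2r d0) wd mulnAC -pE.
  have mk' := mk _ msf.
  have -> : k = (ms 0%R + a ms)%N by rewrite subnKC // (leq_trans _ mk') // leq_addr.
  by rewrite mulnDr [(a ms * _)%N]mulnC.
have fk0 : f@_(mnm2 k 0) = c.
  have := mcoeff_wform 1 1 k f (mnm2 k 0); rewrite wt11 mdeg2 mnm2_0 mnm2_1 addn0 eqxx => <-.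
  rewrite ftop mcoeffZ mpolyXn mcoeffX.
  have -> : (mnm1 0%R *+ k)%MM = mnm2 k 0.
    by apply: mnm2_eq; rewrite mulmnE mnm1E ?mnm2_0 ?mnm2_1 /= ?mul1n.
  by rewrite eqxx mulr1.
have cms := mcoeff_wform p q (p * k)%N f ms; rewrite wms eqxx in cms.
have fms0 : f@_ms != 0 by rewrite -mcoeff_msupp.
have nz : wform p q (p * k)%N f != 0.
  by apply: contraNneq fms0 => e; rewrite -cms e mcoeff0.
case: (stabilized_wform_cases p0 q0 cpq fpq sf nz) => [[c' c'0 e]|].
  by case/eqP: fms0; rewrite -cms e mcoeffZ xk // mulr0.
move=> [L [z [c' [[L0 c'0] kE e z0 sB]]]].
have p1 : p = 1%N.
  apply/eqP; rewrite eqn_leq p0 andbT leqNgt; apply/negP => p1.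
  have [X [Y [dXY fXY]]] := sB.
  apply: (cusp_not_fixed dXY p1 (ltn_trans p1 pq) cpq (z0 _) fXY).
  by rewrite fk0.
move: e fpq pq; rewrite p1 mul1n expr1 => e fpq pq.
by exists q, L, z, c'; split.
Qed.

Lemma autpair_shear z n : autpair ('X_0 : R2) ('X_1 + z *: 'X_0 ^+ n).
Proof.
exists 'X_0, ('X_1 - z *: 'X_0 ^+ n); split; rewrite ?sub2_X0 //.
  by rewrite rmorphB /= sub2Z rmorphXn /= sub2_X0 sub2_X1 addrK.
by rewrite rmorphD /= sub2Z rmorphXn /= sub2_X0 sub2_X1 subrK.
Qed.

(** The shear y + z x^q turns the edge form (y - z x^q)^L into y^L, which lowers the degree to some
    k' and keeps f(0, y), of degree L = k / q. If the new leading form is again a power of x,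
    induction gives k' = m' L with m' < q, and the shears add up to a single polynomial of degree at
    most q. Otherwise the leading form contains y^k', so k' is at most L and the reduction is
    over. *)
Lemma reduce_degree k f g c : autpair f g -> total_deg f = k -> (1 < k)%N -> c != 0 ->
  wform 1 1 k f = c *: 'X_0 ^+ k ->
  exists m P, [/\ (1 < m)%N, (size P <= m.+1)%N, P`_0 = 0 /\ P`_1 = 0,
    k = (m * (size (yrest f)).-1)%N &
    total_deg (sub2 'X_0 ('X_1 + peval P 'X_0) f) = (size (yrest f)).-1].
Proof.
have [N] := ubnP k; elim: N k f g c => // N IH k f g c kN afg fk k1 c0 ftop.
have f1 : (1 < total_deg f)%N by rewrite fk.
have fle : wle 1 1 k f by apply/total_degP; rewrite fk.
have [q [L [z [c' [[q1 L0] kE c'0 fq fqE]]]]] :=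
  newton_edge (autpair_stabilized afg) fle c0 ftop (autpair_mem_y afg f1).
have q0 := ltnW q1; have L0k : (L < k)%N by rewrite kE ltn_Pmull.
pose b : R2 := 'X_1 + z *: 'X_0 ^+ q; pose f' := sub2 'X_0 b f.
have yf' : yrest f' = yrest f by exact: yrest_sub2.
have af' : autpair f' (sub2 'X_0 b g) by apply: autpair_sub2 => //; exact: autpair_shear.
have wb : wle 1 q q b.
  apply: wleD; [exact: wle_X1 | apply: wleZ].
  by rewrite -{2}[q]mul1n; apply: wleX; exact: wle_X0.
have f'q : wle 1 q k f' by apply: (wle_sub2 (wle_X0 _ _) wb fq).
have f'qE : wform 1 q k f' = c' *: 'X_1 ^+ L.
  rewrite /f' wform_sub2 ?fqE //; last exact: wle_X0.
  rewrite wform_X0 sub2Z rmorphXn rmorphB /= sub2Z rmorphXn /= sub2_X0 sub2_X1.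
  congr (_ *: _ ^+ _); rewrite wform_id ?addrK // => m.
  move=> /msuppD_le; rewrite mem_cat => /orP[/mem_msuppXP <-|/msuppZ_le].
    by rewrite /wt !mnm1E /= muln0 muln1.
  rewrite mpolyXn => /mem_msuppXP <-.
  by rewrite /wt !mulmnE !mnm1E /= mul0n !mul1n muln0 addn0.
have y0L : (mnm1 1%R *+ L)%MM = mnm2 0 L.
  by apply: mnm2_eq; rewrite mulmnE mnm1E ?mnm2_0 ?mnm2_1 /= ?mul1n.
have sy : size (yrest f) = L.+1.
  have cL : (yrest f)`_L = c'.
    rewrite -yf' coef_yrest.
    have := mcoeff_wform 1 q k f' (mnm2 0 L); rewrite /wt mnm2_0 mnm2_1 muln0 add0n -kE eqxx => <-.
    by rewrite f'qE mcoeffZ mpolyXn mcoeffX y0L eqxx mulr1.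
  apply/eqP; rewrite eqn_leq; apply/andP; split; last first.
    by rewrite ltnNge; apply: contraNN c'0 => h; rewrite -cL nth_default.
  apply/leq_sizeP => j Lj; rewrite -yf' coef_yrest; apply: memN_msupp_eq0.
  apply/negP => /f'q; rewrite /wt mnm2_0 mnm2_1 muln0 add0n kE leq_pmul2l //.
  by rewrite leqNgt Lj.
rewrite sy /=.
have f'k : (total_deg f' < k)%N.
  have k1' : (k.-1 < k)%N by rewrite ltn_predL ltnW.
  apply: leq_ltn_trans k1'; apply/total_degP => m mf'; rewrite wt11 mdeg2.
  have := f'q m mf'; rewrite leq_eqVlt => /orP[/eqP mk|]; last by rewrite /wt; nia.
  have := mcoeff_wform 1 q k f' m; rewrite mk eqxx f'qE mcoeffZ mpolyXn mcoeffX y0L.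
  case: eqP => [<- _|_]; first by rewrite mnm2_0 mnm2_1 add0n -ltnS prednK ?(ltnW k1).
  by rewrite mulr0 => /esym/eqP; rewrite mcoeff_eq0 mf'.
have y_le j : f'@_(mnm2 0 j) != 0 -> (j <= L)%N.
  rewrite -coef_yrest yf'; apply: contraR; rewrite -ltnNge => Lj.
  by rewrite nth_default // sy.
have L_le : (L <= total_deg f')%N.
  have /total_degP/(_ (mnm2 0 L)) := leqnn (total_deg f').
  rewrite wt11 mdeg2 mnm2_0 mnm2_1; apply; rewrite mcoeff_msupp -coef_yrest yf'.
  have : lead_coef (yrest f) != 0 by rewrite lead_coef_eq0 -size_poly_gt0 sy.
  by rewrite /lead_coef sy.
have done_case : total_deg f' = L -> exists m P, [/\ (1 < m)%N, (size P <= m.+1)%N,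
    P`_0 = 0 /\ P`_1 = 0, k = (m * L)%N & total_deg (sub2 'X_0 ('X_1 + peval P 'X_0) f) = L].
  move=> f'L; exists q, (z *: 'X^q); rewrite pevalZXn -/b; split=> //.
  - by rewrite (leq_trans (size_scale_leq _ _)) // size_polyXn.
  - by rewrite !coefZ !coefXn (ltn_eqF q0) (ltn_eqF q1) !mulr0.
case: (leqP (total_deg f') 1) => [f'1|f'1].
  by apply: done_case; apply/eqP; rewrite eqn_leq L_le (leq_trans f'1).
set k' := total_deg f' in f'k L_le done_case f'1 *.
have f'le : wle 1 1 (1 * k')%N f' by rewrite mul1n; apply/total_degP.
have f'0 : f' != 0 by apply: contraTneq f'1; rewrite /k' => ->; rewrite /total_deg mmeasure0.
have nz : wform 1 1 (1 * k')%N f' != 0.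
  rewrite mul1n; apply/eqP => /(congr1 (mcoeff (mlead f'))); rewrite mcoeff_wform wt11 mcoeff0.
  have -> : mdeg (mlead f') == k' by rewrite /k' /total_deg -mlead_deg.
  by move/eqP; rewrite mleadc_eq0 (negPf f'0).
case: (stabilized_wform_cases _ _ _ f'le (autpair_stabilized af') nz) => // [[c1 c10]|].
  rewrite mul1n => f'top.
  have [|m' [P' [m'1 sP' [P'0 P'1] k'E dP']]] := IH k' f' _ c1 _ af' erefl f'1 c10 f'top.
    exact: leq_trans f'k _.
  rewrite yf' sy /= in k'E dP'.
  have m'q : (m' < q)%N by move: f'k; rewrite k'E kE ltn_pmul2r.
  exists q, (P' + z *: 'X^q); split=> //.
  - apply: leq_trans (size_polyD _ _) _; rewrite geq_max; apply/andP; split.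
      exact: leq_trans sP' (leqW m'q).
    by rewrite (leq_trans (size_scale_leq _ _)) // size_polyXn.
  - by rewrite !coefD P'0 P'1 !coefZ !coefXn (ltn_eqF q0) (ltn_eqF q1) !mulr0 !addr0.
  rewrite -dP' /f' sub2_comp sub2_X0 rmorphD /= sub2Z rmorphXn /= sub2_X0 sub2_X1.
  by rewrite pevalD pevalZXn addrA.
move=> [L' [z' [c1 [[L'0 c10] k'E f'top _ _]]]].
apply: done_case; apply/eqP; rewrite eqn_leq L_le andbT; apply: y_le.
have := mcoeff_wform 1 1 k' f' (mnm2 0 k'); rewrite wt11 mdeg2 mnm2_0 mnm2_1 add0n eqxx => <-.
rewrite mul1n in f'top; rewrite f'top -coef_yrest /yrest bievalZ rmorphXn rmorphB /= bievalZ rmorphXn /=.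
rewrite !expr1 bieval_X0 bieval_X1 mulr0 subr0 coefCM coefXn k'E mul1n eqxx mulr1.
exact: c10.
Qed.

End Reduction.

Section Structure.
Variable K : closedFieldType.
Local Notation R2 := {mpoly K[2]}.
Implicit Types (f g A B : R2) (P Q : {poly K}).

(** A is the linear form whose power is the leading form, normalized to x or y - z x: a point of the
    projective line, at the cost of one parameter. *)
Definition chart A B : Prop :=
  (A = 'X_0 /\ B = 'X_1) \/ exists z, A = 'X_1 - z *: 'X_0 /\ B = 'X_0.

(** Constant and linear terms are excluded so that only the m - 1 coefficients in degrees 2 to m
    count as parameters. *)
Definition superlinear (m : nat) P : Prop :=
  [/\ (size P <= m.+1)%N, P`_0 = 0 & P`_1 = 0].

Lemma autpair_peval P : autpair ('X_0 : R2) ('X_1 + peval P 'X_0).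
Proof.
exists 'X_0, ('X_1 - peval P 'X_0); split; rewrite ?sub2_X0 //.
  by rewrite rmorphB /= sub2_peval sub2_X0 sub2_X1 addrK.
by rewrite rmorphD /= sub2_peval sub2_X0 sub2_X1 subrK.
Qed.

Lemma autpair_chart z : autpair ('X_1 : R2) ('X_0 + z *: 'X_1).
Proof.
exists ('X_1 - z *: 'X_0), 'X_0; split; rewrite ?sub2_X0 ?sub2_X1 //.
  by rewrite rmorphB /= sub2Z sub2_X0 sub2_X1 addrK.
by rewrite rmorphD /= sub2Z sub2_X0 sub2_X1 subrK.
Qed.

Lemma wform_total_deg f : f != 0 -> wform 1 1 (total_deg f) f != 0.
Proof.
move=> f0; apply/eqP => /(congr1 (mcoeff (mlead f))); rewrite mcoeff_wform wt11 mcoeff0.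
have -> : mdeg (mlead f) == total_deg f by rewrite /total_deg -mlead_deg.
by move/eqP; rewrite mleadc_eq0 (negPf f0).
Qed.

(** A leading form that is a power of y - z x is first carried to a power of x by a linear change of
    variables; [reduce_degree] then applies, and undoing both substitutions gives (A, B - P(A)). *)
Lemma autpair_reduction f g : autpair f g -> (1 < total_deg f)%N ->
  exists (m r : nat) P A B f' g',
  [/\ [/\ (1 < m)%N, (0 < r)%N & total_deg f = (m * r)%N],
      superlinear m P, chart A B, autpair f' g' /\ total_deg f' = r &
      f = sub2 A (B - peval P A) f' /\ g = sub2 A (B - peval P A) g'].
Proof.
move=> afg; move kE: (total_deg f) => k k1.
have f0 : f != 0 by apply: contraTneq k1 => f0; rewrite -kE f0 /total_deg mmeasure0.
suff [f1 [g1 [A [B [c [[c0 cAB af1 f1k f1top] [fE gE]]]]]]] : exists f1 g1 A B c,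
    [/\ c != 0, chart A B, autpair f1 g1, total_deg f1 = k & wform 1 1 k f1 = c *: 'X_0 ^+ k] /\
    (f = sub2 A B f1 /\ g = sub2 A B g1).
  have [m [P [m1 sP [P0 P1] kE' dP]]] := reduce_degree af1 f1k k1 c0 f1top.
  set r := (size _).-1 in kE' dP.
  pose f' := sub2 'X_0 ('X_1 + peval P 'X_0) f1.
  pose g' := sub2 'X_0 ('X_1 + peval P 'X_0) g1.
  have back h : sub2 A (B - peval P A) (sub2 'X_0 ('X_1 + peval P 'X_0) h) = sub2 A B h.
    by rewrite sub2_comp rmorphD /= sub2_peval sub2_X0 sub2_X1 subrK.
  exists m, r, P, A, B, f', g'; split=> //.
  - split=> //; rewrite lt0n; apply: contraTneq k1 => r0.
    by rewrite kE' r0 muln0.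
  - by split=> //; apply: autpair_sub2 => //; exact: autpair_peval.
  - by rewrite /f' /g' !back.
have fle : wle 1 1 (1 * k)%N f by rewrite mul1n; apply/total_degP; rewrite kE.
have nz : wform 1 1 (1 * k)%N f != 0 by rewrite mul1n -kE wform_total_deg.
case: (stabilized_wform_cases _ _ _ fle (autpair_stabilized afg) nz) => // [[c c0]|].
  rewrite mul1n => ftop; exists f, g, 'X_0, 'X_1, c; rewrite !sub2_id.
  by split=> //; split=> //; left.
move=> [L [z [c [[L0 c0] kL ftop _ _]]]]; rewrite mul1n in kL; rewrite mul1n -kL in ftop fle.
pose s h : R2 := sub2 'X_1 ('X_0 + z *: 'X_1) h.
have sK h : sub2 ('X_1 - z *: 'X_0) 'X_0 (s h) = h.
  by rewrite /s sub2_comp rmorphD /= sub2Z sub2_X0 sub2_X1 subrK sub2_id.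
have w1 : wle 1 1 1 ('X_0 + z *: 'X_1 : R2).
  by apply: wleD; [exact: wle_X0 | apply: wleZ; exact: wle_X1].
have w1E : wform 1 1 1 ('X_0 + z *: 'X_1 : R2) = 'X_0 + z *: 'X_1.
  by rewrite wformD wformZ wform_X0 wform_X1.
have stop : wform 1 1 k (s f) = c *: 'X_0 ^+ k.
  rewrite /s wform_sub2 ?ftop ?w1E ?wform_X1 //; last exact: wle_X1.
  rewrite sub2Z rmorphXn rmorphB /= sub2Z rmorphXn /= !expr1 sub2_X0 sub2_X1.
  by rewrite addrK.
exists (s f), (s g), ('X_1 - z *: 'X_0), 'X_0, c; rewrite !sK; split=> //; split=> //.
- by right; exists z.
- by apply: autpair_sub2 => //; exact: autpair_chart.
apply/eqP; rewrite eqn_leq; apply/andP; split.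
  by apply/total_degP; apply: (wle_sub2 _ w1 fle); exact: wle_X1.
have := congr1 (mcoeff (mnm1 0%R *+ k)%MM) stop.
rewrite mcoeff_wform mcoeffZ mpolyXn mcoeffX eqxx mulr1 wt11 mdegMn mdeg1 mul1n eqxx => e.
have /total_degP/(_ (mnm1 0%R *+ k)%MM) := leqnn (total_deg (s f)).
by rewrite wt11 mdegMn mdeg1 mul1n mcoeff_msupp e; apply.
Qed.

End Structure.

(** * Structure of the automorphisms *)

Section Tame.
Variable K : closedFieldType.
Local Notation R2 := {mpoly K[2]}.
Implicit Types (f g A B : R2) (P Q : {poly K}).

(** The inverse is (x, G) with G(x, g) = y. In K[x][y] the y-degrees of G and g multiply to 1, and
    the leading coefficients multiply to 1, so that of g is a nonzero constant. *)
Lemma autpair_X0 g : autpair 'X_0 g ->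
  exists c b, g = c *: 'X_1 + peval b ('X_0 : R2).
Proof.
move=> [F [G [FE GE fE gE]]].
rewrite sub2_X0 in fE; rewrite {F}fE in FE gE.
pose h : {rmorphism K -> {poly {poly K}}} := polyC \o @polyC K.
pose eta := bieval h ('X)%:P 'X.
have eG : eta G \Po eta g = 'X.
  rewrite /eta (bieval_comp (h' := h) _ _ _ (t := comp_poly (eta g))); last first.
    by move=> c /=; rewrite comp_polyC.
  rewrite /= comp_polyC comp_polyX.
  have := bieval_sub2 h ('X)%:P 'X 'X_0 g G; rewrite GE bieval_X0 bieval_X1 => ->.
  by [].
have sg : size (eta g) = 2%N.
  have := size_comp_poly (eta G) (eta g); rewrite eG size_polyX.
  move/eqP; rewrite /= eq_sym muln_eq1 => /andP[_ /eqP].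
  by case: (size (eta g)) => // n /= ->.
have lg : size (lead_coef (eta g)) == 1%N.
  have := @lead_coef_comp _ (eta G) (eta g); rewrite sg eG lead_coefX => /(_ isT) e.
  have sG : (size (eta G)).-1 = 1%N.
    have := size_comp_poly (eta G) (eta g); rewrite eG size_polyX sg /= muln1.
    by move=> <-.
  have : size (lead_coef (eta G) * lead_coef (eta g)) == 1%N.
    by rewrite sG expr1 in e; rewrite -e size_poly1.
  by rewrite size_mul_eq1 => /andP[].
case/size_poly1P: lg => c c0; rewrite /lead_coef sg /= => g1.
have etag : eta g = c%:P%:P * 'X + ((eta g)`_0)%:P.
  apply/polyP => -[|[|i]]; rewrite coefD coefMX coefC coefC ?addr0 ?add0r //=.
  by rewrite nth_default // sg.
(* [rho] sends K[x][y] back to K[x,y] and undoes [eta]. *)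
pose ev : {rmorphism {poly K} -> R2} := horner_eval ('X_0 : R2) \o map_poly (@mpolyC 2 K).
pose rho : {rmorphism {poly {poly K}} -> R2} := horner_eval ('X_1 : R2) \o map_poly ev.
have rhoC b : rho b%:P = peval b 'X_0 by rewrite /= map_polyC /horner_eval hornerC.
have rhoX : rho 'X = 'X_1 by rewrite /= map_polyX /horner_eval hornerX.
have rho_eta p : rho (eta p) = p.
  rewrite /eta (bieval_comp (h' := @mpolyC 2 K) _ _ _ (t := rho)); last first.
    by move=> k; rewrite [LHS]rhoC pevalC.
  rewrite rhoC /= map_polyX /horner_eval hornerX.
  by rewrite /peval map_polyX hornerX -sub2_bieval sub2_id.
move: (eta g)`_0 etag => b etag; exists c, b; rewrite -{1}[g]rho_eta etag (rmorphD rho) (rmorphM rho) !rhoC.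
by rewrite pevalC mul_mpolyC rhoX.
Qed.

Lemma total_deg1E f : (total_deg f <= 1)%N ->
  f = f@_(mnm1 0) *: 'X_0 + f@_(mnm1 1) *: 'X_1 + (f@_0%MM)%:MP.
Proof.
move/total_degP => f1; apply/mpolyP => m.
rewrite !mcoeffD !mcoeffZ !mcoeffX mcoeffC.
have [mf|mf] := boolP (m \in msupp f).
  have := f1 m mf; rewrite wt11 leq_eqVlt ltnS leqn0 mdeg_eq0.
  case/orP => [/mdeg1P[i /eqP ->]|/eqP ->].
    rewrite !eq_mnm1 mnm1_eq0 mulr0 addr0.
    by case: (ord2_cases i) => ->; rewrite /= ?mulr1 ?mulr0 ?addr0 ?add0r.
  by rewrite eqxx mulr1 eq_sym mnm1_eq0 eq_sym mnm1_eq0 !mulr0 !add0r.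
rewrite (memN_msupp_eq0 mf).
have z i : f@_(mnm1 i) * (mnm1 i == m)%:R = 0.
  by case: eqP => [->|_]; rewrite ?(memN_msupp_eq0 mf) ?mul0r ?mulr0.
rewrite !z !add0r; case: eqP => [e|]; last by rewrite mulr0.
by rewrite -e (memN_msupp_eq0 mf) mul0r.
Qed.

(** Completing f to linear coordinates (f, D), with D = y if x occurs in f and D = x otherwise,
    makes f the first variable; [autpair_X0] then gives g = k D + Q(f). *)
Lemma autpair_linear f g : autpair f g -> total_deg f = 1%N ->
  exists Q, (total_deg (g - peval Q f) <= 1)%N.
Proof.
move=> afg f1; have := @total_deg1E f; rewrite f1 => /(_ isT) fE.
set al := f@_(mnm1 0) in fE; set be := f@_(mnm1 1) in fE; set c := f@_0%MM in fE.
have d1 i : (total_deg ('X_i : R2) <= 1)%N by rewrite /total_deg msizeX mdeg1.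
have main A B D : autpair A B -> sub2 A B f = 'X_0 -> sub2 f D A = 'X_0 -> sub2 f D B = 'X_1 ->
    (total_deg D <= 1)%N -> exists Q, (total_deg (g - peval Q f) <= 1)%N.
  move=> aAB eAB eA eB D1; have := autpair_sub2 afg aAB; rewrite eAB => ax.
  have [k [b e]] := autpair_X0 ax.
  exists b; have -> : g = sub2 f D (sub2 A B g) by rewrite sub2_comp eA eB sub2_id.
  rewrite e rmorphD /= sub2Z sub2_peval sub2_X0 sub2_X1 addrK.
  by apply/total_degP; apply: wleZ; apply/total_degP.
have [al0|al0] := eqVneq al 0.
  have be0 : be != 0.
    apply: contraPneq f1 => be0; rewrite fE al0 be0 !scale0r !add0r total_degC.
    by [].
  pose B : R2 := be^-1 *: ('X_0 - c%:MP).
  have fB u v : sub2 u v f = be *: v + c%:MP.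
    by rewrite fE al0 scale0r add0r rmorphD /= sub2Z sub2_X1 sub2C.
  have Bf u v : sub2 u v B = be^-1 *: (u - c%:MP).
    by rewrite /B sub2Z rmorphB /= sub2_X0 sub2C.
  have fE' : f = be *: 'X_1 + c%:MP by rewrite fE al0 scale0r add0r.
  have e1 : sub2 'X_1 B f = 'X_0 by rewrite fB /B scalerA mulfV // scale1r subrK.
  have e2 : sub2 f 'X_0 B = 'X_1 by rewrite Bf fE' addrK scalerA mulVf // scale1r.
  apply: (main 'X_1 B 'X_0 _ e1 _ e2 (d1 0)); last by rewrite sub2_X1.
  by exists f, 'X_0; split; rewrite ?sub2_X0 ?sub2_X1.
pose A : R2 := al^-1 *: ('X_0 - be *: 'X_1 - c%:MP).
have fA u v : sub2 u v f = al *: u + be *: v + c%:MP.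
  by rewrite {1}fE !rmorphD /= !sub2Z sub2_X0 sub2_X1 sub2C.
have Af u v : sub2 u v A = al^-1 *: (u - be *: v - c%:MP).
  by rewrite /A sub2Z !rmorphB /= sub2Z sub2_X0 sub2_X1 sub2C.
have e1 : sub2 A 'X_1 f = 'X_0.
  by rewrite fA /A scalerA mulfV // scale1r addrAC subrK subrK.
have e2 : sub2 f 'X_1 A = 'X_0.
  by rewrite Af {1}fE addrAC addrK addrK scalerA mulVf // scale1r.
apply: (main A 'X_1 'X_1 _ e1 e2 _ (d1 1)); last by rewrite sub2_X1.
by exists f, 'X_1; split; rewrite ?sub2_X1.
Qed.

(* Compositions of an affine map, a triangular map of degree q composed on the
   target side, and triangular maps composed on the source side whose degrees
   have product k. *)
Inductive tame (q : nat) : nat -> R2 -> R2 -> Prop :=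
| tame_base f g Q : (total_deg f <= 1)%N -> (total_deg g <= 1)%N -> superlinear q Q ->
    tame q 1 f (g + peval Q f)
| tame_step m r f g A B P : (1 < m)%N -> (0 < r)%N -> superlinear m P -> chart A B ->
    tame q r f g ->
    tame q (m * r) (sub2 A (B - peval P A) f) (sub2 A (B - peval P A) g).

Lemma chart_total_deg A B m P : (1 < m)%N -> chart A B -> superlinear m P ->
  (total_deg A <= m)%N /\ (total_deg (B - peval P A) <= m)%N.
Proof.
move=> m1 cAB [sP _ _].
have d1 i : wle 1 1 1 ('X_i : R2).
  by apply/total_degP; rewrite /total_deg msizeX mdeg1.
have [A1 B1] : wle 1 1 1 A /\ wle 1 1 1 B.
  case: cAB => [[-> ->]|[z [-> ->]]]; first by [].
  by split=> //; apply: wleB => //; apply: wleZ.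
split; apply/total_degP; first exact: wleW (ltnW m1) A1.
apply: wleB; first exact: wleW (ltnW m1) B1.
apply/total_degP; rewrite total_deg_peval -[m]muln1 leq_mul //; last exact/total_degP.
by rewrite -subn1 leq_subLR add1n.
Qed.

Lemma autpair_total_deg_gt0 f g : autpair f g -> (0 < total_deg f)%N.
Proof.
move=> [F [G [_ _ fE _]]]; rewrite lt0n; apply/eqP => /total_deg0 [c e].
move: fE; rewrite e sub2C => /(congr1 (@total_deg K)).
by rewrite total_degC /total_deg msizeX mdeg1.
Qed.

(** The bound on g - Q(f) survives each step, since a substitution of degree m multiplies it by at
    most m and deg f by exactly m. In the linear case the constant and linear terms of Q move into
    the affine part of g. *)
Lemma autpair_tame f g : autpair f g ->
  exists q Q, [/\ q = maxn 1 (size Q).-1, tame q (total_deg f) f g &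
    (total_deg (g - peval Q f) <= total_deg f)%N].
Proof.
have [N] := ubnP (total_deg f); elim: N f g => // N IH f g fN afg.
have [f1|f1] := leqP (total_deg f) 1.
  have fd : total_deg f = 1%N.
    by apply/eqP; rewrite eqn_leq f1 (autpair_total_deg_gt0 afg).
  have [Q Q1] := autpair_linear afg fd.
  exists (maxn 1 (size Q).-1), Q; rewrite fd; split=> //.
  pose Q' := Q - (Q`_0)%:P - Q`_1 *: 'X.
  have Q'E : peval Q f = peval Q' f + (Q`_0)%:MP + Q`_1 *: f.
    rewrite /Q' !pevalB pevalC -['X]expr1 pevalZXn expr1.
    by rewrite addrAC subrK subrK.
  have -> : g = (g - peval Q' f) + peval Q' f by rewrite subrK.
  apply: tame_base => //.
    have -> : g - peval Q' f = (g - peval Q f) + (Q`_0)%:MP + Q`_1 *: f.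
      by rewrite Q'E; ring.
    apply/total_degP; apply: wleD; last by apply: wleZ; apply/total_degP.
    by apply: wleD; [apply/total_degP | exact: wleC].
  split.
  - apply/leq_sizeP => j; rewrite -maxnSS geq_max => /andP[j1 jQ].
    rewrite !coefB coefC coefZ coefX (gtn_eqF (ltnW j1)) (gtn_eqF j1) mulr0 !subr0.
    by rewrite nth_default // (leq_trans _ jQ) // leqSpred.
  - by rewrite !coefB coefC coefZ coefX /= mulr0 subrr subr0.
  - by rewrite !coefB coefC coefZ coefX /= mulr1 subr0 subrr.
have [m [r [P [A [B [f' [g' [[m1 r0 kE] sP cAB [af' f'r] [fE gE]]]]]]]]] :=
  autpair_reduction afg f1.
have rN : (total_deg f' < N)%N.
  by rewrite f'r -ltnS (leq_trans _ fN) // ltnS kE ltn_Pmull.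
have [q [Q [qE t' d']]] := IH f' g' rN af'; rewrite f'r in t' d'.
exists q, Q; split=> //.
  by rewrite kE fE gE; apply: tame_step.
rewrite kE {1}fE gE -sub2_peval -rmorphB /=.
have [Am BPm] := chart_total_deg m1 cAB sP.
exact: total_deg_sub2 Am BPm d'.
Qed.

(** If deg Q > 1, then Q(f) has degree q k > k, which a remainder of degree at most k cannot cancel
    in g, so q k <= n. Otherwise q = 1 and k = deg f. *)
Lemma autpair_tame_degree f g n : autpair f g ->
  (total_deg f <= n)%N -> (total_deg g <= n)%N ->
  exists q k, [/\ (0 < q)%N, (0 < k)%N, (q * k <= n)%N & tame q k f g].
Proof.
move=> afg fn gn; have [q [Q [qE t d]]] := autpair_tame afg.
have k0 := autpair_total_deg_gt0 afg; set k := total_deg f in fn t d k0.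
exists q, k; split=> //; first by rewrite qE leq_max.
rewrite qE; case: (leqP (size Q).-1 1) => [Q1|Q1]; first by rewrite mul1n.
rewrite leqNgt; apply/negP => h.
have : (total_deg (peval Q f) <= maxn n k)%N.
  have -> : peval Q f = g - (g - peval Q f) by rewrite subKr.
  apply/total_degP; apply: wleB; apply/total_degP; rewrite leq_max ?gn //.
  by rewrite d orbT.
rewrite total_deg_peval -/k leq_max leqNgt h /= => /leq_trans/(_ (leqnn k)).
by rewrite -{2}[k]mul1n leq_pmul2r // leqNgt Q1.
Qed.

End Tame.

(** * Polynomial families *)

Section PolynomialFunctions.
Variables (K : comNzRingType) (n : nat).
Implicit Types (u w : 'rV[K]_n -> K).

Definition polyfun u : Prop := exists p : {mpoly K[n]}, forall v, u v = p.@[v ord0].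

Lemma polyfun_ext u w : u =1 w -> polyfun u -> polyfun w.
Proof. by move=> e [p pE]; exists p => v; rewrite -e. Qed.

Lemma polyfun_const c : polyfun (fun=> c).
Proof. by exists c%:MP => v; rewrite mevalC. Qed.

Lemma polyfun_proj i : polyfun (fun v => v ord0 i).
Proof. by exists 'X_i => v; rewrite mevalXU. Qed.

Lemma polyfunD u w : polyfun u -> polyfun w -> polyfun (fun v => u v + w v).
Proof. by move=> [p pE] [q qE]; exists (p + q) => v; rewrite mevalD pE qE. Qed.

Lemma polyfunM u w : polyfun u -> polyfun w -> polyfun (fun v => u v * w v).
Proof. by move=> [p pE] [q qE]; exists (p * q) => v; rewrite mevalM pE qE. Qed.

Lemma polyfun_sum (I : Type) (r : seq I) (F : I -> 'rV[K]_n -> K) :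
  (forall i, polyfun (F i)) -> polyfun (fun v => \sum_(i <- r) F i v).
Proof.
move=> FP; elim: r => [|i r IH].
  by apply: polyfun_ext (polyfun_const 0) => v; rewrite big_nil.
by apply: polyfun_ext (polyfunD (FP i) IH) => v; rewrite big_cons.
Qed.

Lemma polyfun_comp m (u : 'rV[K]_m -> K) (w : 'rV[K]_n -> 'rV[K]_m) :
  (exists p : {mpoly K[m]}, forall v, u v = p.@[v ord0]) ->
  (forall i, polyfun (fun v => w v ord0 i)) -> polyfun (fun v => u (w v)).
Proof.
move=> [p pE] wP; have [q qE] := boolp.choice wP.
exists (p \mPo [tuple q i | i < m]) => v.
by rewrite pE comp_mpoly_meval; apply: meval_eq => i; rewrite tnth_mktuple -qE.
Qed.

(* The i-th coordinate of v, or 0 if there is none. *)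
Definition crd (v : 'rV[K]_n) (i : nat) : K :=
  if insub i is Some j then v ord0 j else 0.

Lemma polyfun_crd i : polyfun (crd^~ i).
Proof.
rewrite /crd; case: insubP => [j _ _|_]; [exact: polyfun_proj | exact: polyfun_const].
Qed.

Lemma crd_row (c : nat -> K) i : (i < n)%N -> crd (\row_j c j) i = c i.
Proof. by move=> ni; rewrite /crd insubT mxE. Qed.

End PolynomialFunctions.

Arguments polyfun_const {K n} c.
Arguments polyfun_proj {K n} i.
Arguments polyfun_crd {K n} i.

Section PolynomialFamilies.
Variables (K : closedFieldType) (n : nat).
Local Notation R2 := {mpoly K[2]}.
Implicit Types (F G : 'rV[K]_n -> R2).

(** The degree bound uniform in v makes a substitution expand over a fixed finite set of monomials,
    so that composites of families are again families. *)
Definition polyfam F : Prop :=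
  (exists d, forall v, wle 1 1 d (F v)) /\ forall m, polyfun (fun v => (F v)@_m).

Lemma polyfam_ext F G : F =1 G -> polyfam F -> polyfam G.
Proof. by move=> /funext ->. Qed.

Lemma polyfam_const f : polyfam (fun=> f).
Proof.
split=> [|m]; last exact: polyfun_const.
by exists (total_deg f) => v; apply/total_degP.
Qed.

Lemma polyfamD F G : polyfam F -> polyfam G -> polyfam (fun v => F v + G v).
Proof.
move=> [[d Fd] FP] [[e Ge] GP]; split=> [|m].
  exists (maxn d e) => v; apply: wleD; [apply: wleW (Fd v) | apply: wleW (Ge v)].
    exact: leq_maxl.
  exact: leq_maxr.
by apply: polyfun_ext (polyfunD (FP m) (GP m)) => v; rewrite mcoeffD.
Qed.

Lemma polyfamZ (u : 'rV[K]_n -> K) F : polyfun u -> polyfam F -> polyfam (fun v => u v *: F v).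
Proof.
move=> uP [[d Fd] FP]; split=> [|m]; first by exists d => v; apply: wleZ.
by apply: polyfun_ext (polyfunM uP (FP m)) => v; rewrite mcoeffZ.
Qed.

Lemma polyfamB F G : polyfam F -> polyfam G -> polyfam (fun v => F v - G v).
Proof.
move=> FP GP; apply: polyfam_ext (polyfamD FP (polyfamZ (polyfun_const (-1)) GP)) => v.
by rewrite scaleN1r.
Qed.

Lemma polyfamM F G : polyfam F -> polyfam G -> polyfam (fun v => F v * G v).
Proof.
move=> [[d Fd] FP] [[e Ge] GP]; split=> [|m].
  by exists (d + e)%N => v; apply: wleM.
have h (k : 'X_{1..2 < (mdeg m).+1, (mdeg m).+1}) :
    polyfun (fun v => if m == (k.1 + k.2)%MM then (F v)@_k.1 * (G v)@_k.2 else 0).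
  by case: eqP => _; [exact: polyfunM | exact: polyfun_const].
apply: polyfun_ext (polyfun_sum (index_enum _) h) => v.
by rewrite mcoeffM [RHS]big_mkcond.
Qed.

Lemma polyfamX F k : polyfam F -> polyfam (fun v => F v ^+ k).
Proof.
move=> FP; elim: k => [|k IH]; first by apply: polyfam_ext (polyfam_const 1) => v; rewrite expr0.
by apply: polyfam_ext (polyfamM FP IH) => v; rewrite exprS.
Qed.

Lemma polyfam_sum (I : Type) (r : seq I) (F : I -> 'rV[K]_n -> R2) :
  (forall i, polyfam (F i)) -> polyfam (fun v => \sum_(i <- r) F i v).
Proof.
move=> FP; elim: r => [|i r IH].
  by apply: polyfam_ext (polyfam_const 0) => v; rewrite big_nil.
by apply: polyfam_ext (polyfamD (FP i) IH) => v; rewrite big_cons.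
Qed.

Lemma sub2_bounded d (a b f : R2) : wle 1 1 d f ->
  sub2 a b f = \sum_(m : 'X_{1..2 < d.+1}) f@_m *: (a ^+ (m : 'X_{1..2}) 0 * b ^+ (m : 'X_{1..2}) 1).
Proof.
move=> /total_degP fd; rewrite sub2_bieval bieval_mmap (mmapE d.+1).
  by apply: eq_bigr => m _; rewrite mul_mpolyC /mmap1 big_ord2.
by rewrite (leq_trans (leqSpred _)).
Qed.

Lemma polyfam_sub2 A B F : polyfam A -> polyfam B -> polyfam F ->
  polyfam (fun v => sub2 (A v) (B v) (F v)).
Proof.
move=> AP BP FP; have [[d Fd] FPm] := FP.
have e v := sub2_bounded (A v) (B v) (Fd v).
apply: polyfam_ext (fun v => esym (e v)) _; apply: polyfam_sum => m.
by apply: polyfamZ => //; apply: polyfamM; apply: polyfamX.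
Qed.

Lemma polyfam_comp m (F : 'rV[K]_m -> R2) (w : 'rV[K]_n -> 'rV[K]_m) :
  (exists d, forall v, wle 1 1 d (F v)) ->
  (forall k, exists p : {mpoly K[m]}, forall v, (F v)@_k = p.@[v ord0]) ->
  (forall i, polyfun (fun v => w v ord0 i)) -> polyfam (fun v => F (w v)).
Proof.
move=> [d Fd] FP wP; split=> [|k]; first by exists d.
exact: polyfun_comp (FP k) wP.
Qed.

End PolynomialFamilies.

Arguments polyfam_const {K n} f.

Section Coverings.
Variable K : closedFieldType.
Local Notation R2 := {mpoly K[2]}.
Implicit Types (n : nat) (S : R2 -> R2 -> Prop) (P Q : {poly K}).

(* S lies in the union of the images of finitely many polynomial maps from the
   n-dimensional affine space. *)
Definition covered n S : Prop :=
  exists (J : nat) (F G : nat -> 'rV[K]_n -> R2),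
    (forall j, polyfam (F j) /\ polyfam (G j)) /\
    forall f g, S f g -> exists j v, [/\ (j < J)%N, f = F j v & g = G j v].

Lemma covered_subset n S S' : (forall f g, S f g -> S' f g) -> covered n S' -> covered n S.
Proof. by move=> SS' [J [F [G [FG cov]]]]; exists J, F, G; split=> // f g /SS' /cov. Qed.

Lemma covered_empty n S : (forall f g, ~ S f g) -> covered n S.
Proof.
move=> S0; exists 0%N, (fun _ _ => 0), (fun _ _ => 0); split; last by move=> f g /S0.
by move=> _; split; apply: polyfam_const.
Qed.

Lemma covered_union n S S' : covered n S -> covered n S' ->
  covered n (fun f g => S f g \/ S' f g).
Proof.
move=> [J [F [G [FG cov]]]] [J' [F' [G' [FG' cov']]]].
exists (J + J')%N, (fun j => if (j < J)%N then F j else F' (j - J)%N),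
  (fun j => if (j < J)%N then G j else G' (j - J)%N).
split=> [j|f g]; first by case: ifP.
case=> [/cov|/cov'] [j [v [jJ -> ->]]].
  by exists j, v; rewrite jJ (leq_trans jJ) // leq_addr.
exists (J + j)%N, v; rewrite ltn_add2l jJ; split=> //;
by rewrite ltnNge leq_addr /= addKn.
Qed.

Lemma covered_bigunion n (N : nat) (S : nat -> R2 -> R2 -> Prop) :
  (forall i, (i < N)%N -> covered n (S i)) ->
  covered n (fun f g => exists2 i, (i < N)%N & S i f g).
Proof.
elim: N => [|N IH] cS; first by apply: covered_empty => f g [].
apply: covered_subset (covered_union (IH _) (cS N (ltnSn N))); last first.
  by move=> i iN; apply: cS; apply: leqW.
move=> f g [i]; rewrite ltnS leq_eqVlt => /orP[/eqP -> |iN] Sfg; first by right.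
by left; exists i.
Qed.

Lemma covered_weaken n n' S : (n <= n')%N -> covered n S -> covered n' S.
Proof.
move=> nn' [J [F [G [FG cov]]]].
pose w (v : 'rV[K]_n') : 'rV[K]_n := \row_i crd v i.
have wP i : polyfun (fun v => w v ord0 i).
  by apply: polyfun_ext (polyfun_crd i) => v; rewrite mxE.
exists J, (fun j v => F j (w v)), (fun j v => G j (w v)); split=> [j|f g].
  by have [[? ?] [? ?]] := FG j; split; apply: polyfam_comp.
move=> /cov [j [v [jJ -> ->]]]; exists j, (\row_i crd v i).
suff -> : w (\row_i crd v i) = v by [].
apply/rowP => i; rewrite mxE (crd_row (crd v)) ?(leq_trans _ nn') //.
by rewrite /crd valK.
Qed.

Lemma superlinear_pevalE m P a : superlinear m P ->
  peval P a = \sum_(l < m.-1) P`_l.+2 *: a ^+ l.+2.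
Proof.
move=> [sP P0 P1]; rewrite pevalE (@sum_coef_widen _ _ _ (fun l => a ^+ l) m.+1) //.
case: m sP => [|m] sP; first by rewrite big_ord_recl !big_ord0 P0 scale0r addr0.
by rewrite !big_ord_recl P0 P1 !scale0r !add0r.
Qed.

(* Parameters: the coefficients of f0 and g0, then those of Q. *)
Lemma covered_base q : (0 < q)%N -> covered (q + 5)%N (fun f g =>
  exists f0 g0 Q, [/\ (total_deg f0 <= 1)%N, (total_deg g0 <= 1)%N, superlinear q Q,
     f = f0 & g = g0 + peval Q f0]).
Proof.
move=> q0; pose n := (q + 5)%N.
pose lin i (v : 'rV[K]_n) : R2 :=
  crd v i *: 'X_0 + crd v i.+1 *: 'X_1 + crd v i.+2 *: 1.
have linP i : polyfam (lin i).
  by do 2?[apply: polyfamD]; apply: polyfamZ (polyfun_crd _) (polyfam_const _).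
pose top v : R2 := lin 3 v + \sum_(l < q.-1) crd v (6 + l) *: lin 0 v ^+ l.+2.
exists 1%N, (fun _ => lin 0), (fun _ => top); split=> [_|f g].
  split=> //; apply: polyfamD => //; apply: polyfam_sum => l.
  by apply: polyfamZ; [exact: polyfun_crd | exact: polyfamX].
move=> [f0 [g0 [Q [f1 g1 sQ -> ->]]]].
pose s : seq K := [:: f0@_(mnm1 0); f0@_(mnm1 1); f0@_0%MM; g0@_(mnm1 0);
                   g0@_(mnm1 1); g0@_0%MM].
pose c i := if (i < 6)%N then s`_i else Q`_(i - 6).+2.
pose v : 'rV[K]_n := \row_j c j.
have vE i : (i < q + 5)%N -> crd v i = c i by exact: crd_row.
have e0 : lin 0%N v = f0.
  rewrite [RHS](total_deg1E f1) /lin !vE ?(leq_trans _ (leq_addl _ _)) //.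
  by rewrite -[_ *: 1]mul_mpolyC mulr1.
exists 0%N, v; rewrite e0; split=> //; rewrite /top e0; congr (_ + _).
  rewrite {1}(total_deg1E g1) /lin !vE; try by [lia].
  by rewrite -[_ *: 1]mul_mpolyC mulr1.
rewrite (superlinear_pevalE _ sQ); apply: eq_bigr => l _.
rewrite vE; last by have := ltn_ord l; lia.
by rewrite /c /= addKn.
Qed.

(* Parameters: those of S, then the slope of the chart, then the coefficients
   of P. *)
Lemma covered_step n m S : (1 < m)%N -> covered n S -> covered (n + m)%N (fun f g =>
  exists f' g' A B P, [/\ S f' g', superlinear m P, chart A B,
    f = sub2 A (B - peval P A) f' & g = sub2 A (B - peval P A) g']).
Proof.
move=> m1 [J [F [G [FG cov]]]].
pose w (v : 'rV[K]_(n + m)) : 'rV[K]_n := \row_i crd v i.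
have wP i : polyfun (fun v => w v ord0 i).
  by apply: polyfun_ext (polyfun_crd i) => v; rewrite mxE.
have FwP j : polyfam (fun v => F j (w v)).
  by have [[? ?] _] := FG j; apply: polyfam_comp.
have GwP j : polyfam (fun v => G j (w v)).
  by have [_ [? ?]] := FG j; apply: polyfam_comp.
(* Indices below J use the chart (x, y); those shifted by J use the charts (y - z x, x), with z the
   parameter number n. *)
pose A j : 'rV[K]_(n + m) -> R2 :=
  if (j < J)%N then fun=> 'X_0 else fun v => 'X_1 - crd v n *: 'X_0.
pose B j : 'rV[K]_(n + m) -> R2 := if (j < J)%N then fun=> 'X_1 else fun=> 'X_0.
pose T j v := B j v - \sum_(l < m.-1) crd v (n.+1 + l) *: A j v ^+ l.+2.
have AP j : polyfam (A j).
  rewrite /A; case: ifP => _; first exact: polyfam_const.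
  apply: polyfamB; first exact: polyfam_const.
  by apply: polyfamZ (polyfun_crd _) (polyfam_const _).
have TP j : polyfam (T j).
  apply: polyfamB; first by rewrite /B; case: ifP => _; exact: polyfam_const.
  apply: polyfam_sum => l; apply: polyfamZ; first exact: polyfun_crd.
  exact: polyfamX.
pose i j := if (j < J)%N then j else (j - J)%N.
exists (J + J)%N, (fun j v => sub2 (A j v) (T j v) (F (i j) (w v))),
  (fun j v => sub2 (A j v) (T j v) (G (i j) (w v))).
split=> [j|f g [f' [g' [A' [B' [P [/cov [j [v [jJ -> ->]]] sP cAB -> ->]]]]]]].
  split; first exact: polyfam_sub2 (AP j) (TP j) (FwP (i j)).
  exact: polyfam_sub2 (AP j) (TP j) (GwP (i j)).
pose c (z : K) k := if (k < n)%N then crd v k else if k == n then z else P`_(k - n.+1).+2.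
pose u z : 'rV[K]_(n + m) := \row_k c z k.
have uE z k : (k < n + m)%N -> crd (u z) k = c z k by exact: crd_row.
have wu z : w (u z) = v.
  apply/rowP => k; rewrite mxE uE; last by rewrite (leq_trans (ltn_ord k)) // leq_addr.
  by rewrite /c ltn_ord /crd valK.
have nm : (n < n + m)%N by move: m1; clear; lia.
have un z : crd (u z) n = z.
  by rewrite uE ?ltnS // /c ltnn eqxx.
have TE z k : A k (u z) = A' -> B k (u z) = B' -> T k (u z) = B' - peval P A'.
  move=> eA eB; rewrite /T eB eA; congr (_ - _); rewrite (superlinear_pevalE _ sP).
  apply: eq_bigr => l _; rewrite uE; last by have := ltn_ord l; lia.
  by rewrite /c ltnNge leqW ?leq_addr //= gtn_eqF ?addKn // ltnS leq_addr.
case: cAB => [[eA eB]|[z [eA eB]]].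
  exists j, (u 0).
  have eA' : A j (u 0) = A' by rewrite /A jJ.
  have eB' : B j (u 0) = B' by rewrite /B jJ.
  by rewrite (TE _ _ eA' eB') eA' wu /i jJ; split=> //; rewrite (leq_trans jJ) // leq_addr.
have nJ : (J + j < J)%N = false by rewrite ltnNge leq_addr.
exists (J + j)%N, (u z).
have eA' : A (J + j)%N (u z) = A' by rewrite /A nJ un.
have eB' : B (J + j)%N (u z) = B' by rewrite /B nJ.
by rewrite (TE _ _ eA' eB') eA' wu /i nJ addKn; split=> //; rewrite ltn_add2l.
Qed.

(** A step of degree m costs m parameters: a slope and m - 1 coefficients. For m, r >= 2 the
    induction closes with m + r <= m r; for r = 1 no step remains, hence the separate value 0. *)
Lemma covered_tame q k : (0 < q)%N -> (0 < k)%N ->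
  covered (q + 5 + (if k == 1 then 0 else k))%N (tame q k).
Proof.
move=> q0; have [N] := ubnP k; elim: N k => // N IH k kN k0.
set n := (_ + _)%N.
pose base (f g : R2) := exists f0 g0 Q, [/\ (total_deg f0 <= 1)%N, (total_deg g0 <= 1)%N,
  superlinear q Q, f = f0 & g = g0 + peval Q f0].
pose step m (f g : R2) := (exists2 r, ((1 < m) && (0 < r))%N & (m * r == k)%N) /\
  exists f' g' A B P, [/\ tame q (k %/ m) f' g', superlinear m P, chart A B,
    f = sub2 A (B - peval P A) f' & g = sub2 A (B - peval P A) g'].
apply: (covered_subset (S' := fun f g => base f g \/ exists2 m, (m < k.+1)%N & step m f g)).
  move=> f g t; case: t kN k0 @n @step => [f0 g0 Q f1 g1 sQ|m r f' g' A B P m1 r0 sP cAB t] _ k0 n step.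
    by left; exists f0, g0, Q.
  right; exists m; first by rewrite ltnS leq_pmulr.
  split; first by exists r => //; rewrite m1.
  by exists f', g', A, B, P; rewrite mulKn // ltnW.
apply: covered_union.
  by apply: covered_weaken (covered_base q0); rewrite leq_addr.
apply: covered_bigunion => m _.
have [[r mr /eqP kE]|h] := pselect (exists2 r, ((1 < m) && (0 < r))%N & (m * r == k)%N); last first.
  by apply: covered_empty => f g [].
have /andP[m1 r0] := mr.
have rk : (r < k)%N by rewrite -kE ltn_Pmull.
have cr := IH r (leq_trans rk kN) r0.
apply: (covered_subset (S' := fun f g => exists f' g' A B P,
  [/\ tame q r f' g', superlinear m P, chart A B,
    f = sub2 A (B - peval P A) f' & g = sub2 A (B - peval P A) g'])).
  by move=> f g [_]; rewrite -kE mulKn // ltnW.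
apply: covered_weaken (covered_step m1 cr).
rewrite /n -addnA leq_add2l -kE; case: (eqVneq r 1%N) => [->|r1].
  by rewrite muln1 (gtn_eqF m1).
have r2 : (1 < r)%N by rewrite ltn_neqAle eq_sym r1.
by rewrite (gtn_eqF (leq_trans m1 (leq_pmulr m r0))); nia.
Qed.

(** For q, k >= 1 one has q + k <= q k + 1 <= n + 1, and five more parameters give n + 6; the value
    is reached for q = 1 and k = n. *)
Lemma covered_autpair n : covered (n + 6)%N (fun f g =>
  [/\ autpair f g, (total_deg f <= n)%N & (total_deg g <= n)%N]).
Proof.
apply: (covered_subset (S' := fun f g => exists2 q, (q < n.+1)%N &
  exists2 k, (k < n.+1)%N & [/\ (0 < q)%N, (0 < k)%N, (q * k <= n)%N & tame q k f g])).
  move=> f g [afg fn gn]; have [q [k [q0 k0 qk t]]] := autpair_tame_degree afg fn gn.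
  exists q; first by rewrite ltnS (leq_trans _ qk) // leq_pmulr.
  by exists k => //; rewrite ltnS (leq_trans _ qk) // leq_pmull.
apply: covered_bigunion => q _; apply: covered_bigunion => k _.
have [/and3P[q0 k0 qk]|h] := boolP [&& 0 < q, 0 < k & q * k <= n]%N; last first.
  by apply: covered_empty => f g [q0 k0 qk]; case/negP: h; rewrite q0 k0.
apply: (covered_subset (S' := tame q k)); first by move=> f g [].
apply: covered_weaken (covered_tame q0 k0).
by case: eqP => k1; nia.
Qed.

End Coverings.

(** * Dimension *)

Section AlgebraicDependence.
Variable K : fieldType.

Definition mdeg_le n (N : nat) (p : {mpoly K[n]}) : Prop :=
  forall c, c \in msupp p -> (mdeg c <= N)%N.

Lemma mdeg_leM n N N' (p q : {mpoly K[n]}) :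
  mdeg_le N p -> mdeg_le N' q -> mdeg_le (N + N')%N (p * q).
Proof.
move=> pN qN c /msuppM_le /allpairsP [[c1 c2] /= [c1p c2q ->]].
by rewrite mdegD leq_add ?pN ?qN.
Qed.

Lemma mdeg_le1 n N : mdeg_le N (1 : {mpoly K[n]}).
Proof. by move=> c; rewrite -mpolyC1 msupp1 inE => /eqP ->; rewrite mdeg0. Qed.

Lemma mdeg_leX n N (p : {mpoly K[n]}) k : mdeg_le N p -> mdeg_le (k * N)%N (p ^+ k).
Proof.
move=> pN; elim: k => [|k IH]; first by rewrite expr0; exact: mdeg_le1.
by rewrite exprS mulSn; apply: mdeg_leM.
Qed.

Lemma mdeg_le_prod n d N (F : 'I_d -> {mpoly K[n]}) :
  (forall i, mdeg_le N (F i)) -> mdeg_le (d * N)%N (\prod_i F i).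
Proof.
elim: d F => [|d IH] F FN; first by rewrite big_ord0; exact: mdeg_le1.
by rewrite big_ord_recl mulSn; apply: mdeg_leM => //; apply: IH.
Qed.

(* Among the B^d monomials of partial degrees < B in the u i, whose partial
   degrees are less than ((d e).+1 B), a linear relation exists as soon as
   B^d > ((d e).+1 B)^m. *)
Lemma algebraically_dependent (m d : nat) (u : 'I_d -> {mpoly K[m]}) : (m < d)%N ->
  exists2 p : {mpoly K[d]}, p != 0 & p \mPo [tuple u i | i < d] = 0.
Proof.
move=> md.
pose e := (\max_i msize (u i))%N.
have ue i : mdeg_le e (u i).
  move=> c /msize_mdeg_lt h; apply: leq_trans (ltnW h) _.
  by rewrite /e (bigD1 i) //= leq_maxl.
(* B exceeds E^m, so that B^d >= B^(m+1) > (E B)^m. *)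
pose E := (d * e).+1; pose B := (E ^ m).+1; pose M := (E * B)%N.
pose I := {ffun 'I_d -> 'I_B}; pose J := {ffun 'I_m -> 'I_M}.
have card_lt : (#|J| < #|I|)%N.
  rewrite !card_ffun !card_ord /M expnMn.
  apply: leq_trans (_ : B ^ m.+1 <= _)%N; last exact: leq_pexp2l.
  by rewrite expnS ltn_pmul2r ?expn_gt0 // /B ltnS.
pose mnmI (a : I) : 'X_{1..d} := [multinom (a i : nat) | i < d].
pose mnmJ (c : J) : 'X_{1..m} := [multinom (c i : nat) | i < m].
pose w (a : I) : {mpoly K[m]} := \prod_(i < d) u i ^+ a i.
have wM a c : c \in msupp (w a) -> exists c' : J, c = mnmJ c'.
  move=> cw; have : mdeg_le (d * (B.-1 * e))%N (w a).
    apply: mdeg_le_prod => i; have := @mdeg_leX _ _ _ (a i) (ue i) => h c' /h h'.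
    by rewrite (leq_trans h') // leq_mul2r -ltnS prednK // ltn_ord orbT.
  move=> /(_ c cw) cdeg.
  have cM i : (c i < M)%N.
    apply: leq_ltn_trans (_ : mdeg c < M)%N; first by rewrite mdegE (bigD1 i) //= leq_addr.
    by apply: leq_ltn_trans cdeg _; rewrite /M /E /=; nia.
  exists [ffun i => Ordinal (cM i)]; apply/mnmP => i.
  by rewrite mnmE ffunE.
pose A : 'M[K]_(#|I|, #|J|) := \matrix_(i, j) (w (enum_val i))@_(mnmJ (enum_val j)).
have kA : kermx A != 0.
  rewrite kermx_eq0 /row_free neq_ltn; apply/orP; left.
  by apply: leq_ltn_trans card_lt; exact: rank_leq_col.
have [v /sub_kermxP vA v0] := rowV0Pn kA.
pose p : {mpoly K[d]} := \sum_(i < #|I|) v ord0 i *: 'X_[mnmI (enum_val i)].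
have mnmI_inj : injective mnmI.
  move=> a a' /mnmP aa; apply/ffunP => i; apply/val_inj.
  by have := aa i; rewrite !mnmE.
exists p.
  apply: contraNneq v0 => p0; apply/eqP/rowP => i; rewrite mxE.
  have := congr1 (mcoeff (mnmI (enum_val i))) p0; rewrite mcoeff0 /p raddf_sum /=.
  rewrite (bigD1 i) //= mcoeffZ mcoeffX eqxx mulr1 big1 ?addr0 // => j ji.
  rewrite mcoeffZ mcoeffX; case: eqP => [/mnmI_inj/enum_val_inj e'|]; last by rewrite mulr0.
  by rewrite e' eqxx in ji.
have pE : p \mPo [tuple u i | i < d] = \sum_(i < #|I|) v ord0 i *: w (enum_val i).
  rewrite /p raddf_sum /=; apply: eq_bigr => i _; rewrite comp_mpolyZ comp_mpolyX.
  by congr (_ *: _); apply: eq_bigr => j _; rewrite tnth_mktuple mnmE.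
rewrite pE; apply/mpolyP => c; rewrite mcoeff0 raddf_sum /=.
have [[c' ->]|nc] := pselect (exists c' : J, c = mnmJ c').
  have := congr1 (fun B' : 'rV[K]_#|J| => B' ord0 (enum_rank c')) vA.
  rewrite mxE [RHS]mxE => vA0; rewrite -[RHS]vA0; apply: eq_bigr => i _.
  by rewrite mxE mcoeffZ enum_rankK.
rewrite big1 // => i _; rewrite mcoeffZ memN_msupp_eq0 ?mulr0 //.
by apply/negP => /wM.
Qed.

End AlgebraicDependence.

Section Dimension.
Local Open Scope classical_set_scope.
Variables (K : closedFieldType) (N : nat).
Implicit Types (A X Z : set 'rV[K]_N) (p q : {mpoly K[N]}).

Lemma zariski_closed_locus1 p : zariski_closed [set v : 'rV[K]_N | p.@[v ord0] = 0].
Proof.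
exists [set p]; apply/seteqP; split=> v /=; first by move=> pv q ->.
by move=> /(_ p); apply.
Qed.

Lemma irreducible_prime Z p q : zariski_irreducible Z ->
  (forall v, Z v -> (p * q).@[v ord0] = 0) ->
  (forall v, Z v -> p.@[v ord0] = 0) \/ (forall v, Z v -> q.@[v ord0] = 0).
Proof.
move=> [_ irr] h.
case: (irr _ _ (zariski_closed_locus1 p) (zariski_closed_locus1 q)) => [v Zv||].
- by have := h v Zv; rewrite mevalM => /eqP; rewrite mulf_eq0 => /orP[/eqP|/eqP] ?; [left|right].
- by move=> pz; left.
- by move=> qz; right.
Qed.

Lemma closed_avoid Z v : zariski_closed Z -> ~ Z v ->
  exists2 p, forall w, Z w -> p.@[w ord0] = 0 & p.@[v ord0] != 0.
Proof.
move=> [S ->] /= h; apply: contrapT => h'; apply: h => p Sp; apply/eqP/negPn/negP => pv.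
by apply: h'; exists p => // w; apply.
Qed.

Lemma zariski_closure_sub A Z : zariski_closed Z -> A `<=` Z -> zariski_closure A `<=` Z.
Proof. by move=> cZ AZ v; apply; split. Qed.

Lemma sub_zariski_closure A : A `<=` zariski_closure A.
Proof. by move=> v Av Z [_]; apply. Qed.

(* If a_i vanishes on C_i but not on C_{i+1}, then the a_i are algebraically
   independent modulo the ideal of C_d: dividing a relation by the largest power
   of a_{d-1} and restricting to C_{d-1} gives a shorter relation. *)
Lemma chain_independent d (C : nat -> set 'rV[K]_N) (a : nat -> {mpoly K[N]})
    (p : {mpoly K[d]}) :
  (forall i, (i <= d)%N -> zariski_irreducible (C i)) ->
  (forall i, (i < d)%N -> [/\ C i `<=` C i.+1, forall v, C i v -> (a i).@[v ord0] = 0 &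
     exists2 v, C i.+1 v & (a i).@[v ord0] != 0]) ->
  (forall v, C d v -> p.@[fun i : 'I_d => (a i).@[v ord0]] = 0) -> p = 0.
Proof.
elim: d p => [|d IH] p irr ch pz.
  have [[v Cv] _] := irr 0%N isT; have := pz v Cv.
  by rewrite (nvar0_mpolyC p) mevalC => ->; rewrite mpolyC0.
apply/eqP/negPn/negP => p0.
have [CC a0 [v1 Cv1 av1]] := ch d (ltnSn d).
pose s := msupp p; have s0 : s != [::] by rewrite msupp_eq0.
have [|ms mss msmin] := @min_ratio _ (fun m : 'X_{1..d.+1} => m ord_max) (fun=> 1%N) s s0.
  by [].
set k := ms ord_max in msmin.
have kle m : m \in msupp p -> (k <= m ord_max)%N.
  by move=> /msmin; rewrite !muln1.
pose res (m : 'X_{1..d.+1}) : 'X_{1..d} := [multinom m (widen_ord (leqnSn d) i) | i < d].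
have res_inj (m m' : 'X_{1..d.+1}) : m ord_max = m' ord_max -> res m = res m' -> m = m'.
  move=> e0 /mnmP e1; apply/mnmP => i; case: (unliftP ord_max i) => [j ->|-> //].
  have -> : lift ord_max j = widen_ord (leqnSn d) j.
    by apply/val_inj; rewrite /= /bump leqNgt ltn_ord.
  by have := e1 j; rewrite !mnmE.
(* This is p divided by the k-th power of the last variable and restricted to last variable 0; it is
   nonzero because the exponent k occurs in p. *)
pose p0' : {mpoly K[d]} := \sum_(m <- s | m ord_max == k) p@_m *: 'X_[res m].
have p0'n0 : p0' != 0.
  apply/eqP => /(congr1 (mcoeff (res ms))); rewrite mcoeff0 /p0' raddf_sum /=.
  rewrite big_mkcond (bigD1_seq ms) ?msupp_uniq //= eqxx mcoeffZ mcoeffX eqxx mulr1 big1.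
    by rewrite addr0 => /eqP; rewrite mcoeff_eq0 mss.
  move=> m mms; case: eqP => // mk; rewrite mcoeffZ mcoeffX; case: eqP => [e|]; last by rewrite mulr0.
  by case/eqP: mms; apply: res_inj.
case/eqP: p0'n0; apply: IH => [i id|i id|v Cv].
- by apply: irr; apply: leqW.
- by apply: ch; apply: leqW.
pose b (i : 'I_d.+1) := a i.
(* [r] is the quotient of the relation by the k-th power of a_d. It vanishes on the irreducible top
   set, where a_d is not identically zero. *)
pose r : {mpoly K[N]} := \sum_(m <- s) p@_m *:
  ((\prod_(i < d) a i ^+ m (widen_ord (leqnSn d) i)) * a d ^+ (m ord_max - k)).
have pr w : p.@[fun i : 'I_d.+1 => (a i).@[w ord0]] = ((a d ^+ k) * r).@[w ord0].
  rewrite mevalE mulr_sumr raddf_sum /=; apply: eq_big_seq => m /kle km.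
  rewrite -scalerAr mevalZ mulrCA -exprD subnKC // big_ord_recr /= mevalM.
  by rewrite rmorph_prod rmorphXn /=; congr (_ * (_ * _)); apply: eq_bigr => i _; rewrite rmorphXn.
have rz : forall w, C d.+1 w -> r.@[w ord0] = 0.
  have [|h|//] := irreducible_prime (p := a d ^+ k) (q := r) (irr d.+1 (leqnn _)).
    by move=> w Cw; rewrite -pr pz.
  have := h v1 Cv1; rewrite rmorphXn /= => /eqP; rewrite expf_eq0 (negPf av1) andbF.
  by [].
have := rz v (CC v Cv); rewrite /r raddf_sum /= => <-.
rewrite /p0' raddf_sum /= big_mkcond; apply: eq_big_seq => m /kle km.
rewrite !mevalZ mevalX mevalM rmorph_prod [in RHS]rmorphXn /= (a0 v Cv).
case: eqP => [->|mk].
  rewrite subnn expr0 mulr1; congr (_ * _); apply: eq_bigr => i _.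
  by rewrite mnmE rmorphXn.
rewrite expr0n subn_eq0 leqNgt ltn_neqAle km andbT eq_sym; move/eqP: mk => ->.
by rewrite !mulr0.
Qed.

Lemma zariski_closed_closure A : zariski_closed (zariski_closure A).
Proof.
exists [set p | forall v, A v -> p.@[v ord0] = 0]; apply/seteqP; split=> v.
  move=> Av p pA; apply: (Av [set w | p.@[w ord0] = 0]).
  by split=> //; exact: zariski_closed_locus1.
move=> vz Z [cZ AZ]; apply: contrapT => nZ.
have [p pZ] := closed_avoid cZ nZ; case/eqP; apply: vz => w /AZ; exact: pZ.
Qed.

Lemma vanish_closure A p : (forall v, A v -> p.@[v ord0] = 0) ->
  forall v, zariski_closure A v -> p.@[v ord0] = 0.
Proof.
move=> pA v; apply: (zariski_closure_sub (Z := [set w | p.@[w ord0] = 0])) => //.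
exact: zariski_closed_locus1.
Qed.

(** The third hypothesis says that Z lies in the closure of the union. If no F j contained Z, a
    product of polynomials, each vanishing on one F j but not on Z, would vanish on the union and
    not on Z. *)
Lemma irreducible_finite_union Z (J : nat) (F : nat -> set 'rV[K]_N) :
  zariski_irreducible Z -> (forall j, zariski_closed (F j)) ->
  (forall p, (forall j v, (j < J)%N -> F j v -> p.@[v ord0] = 0) ->
             forall v, Z v -> p.@[v ord0] = 0) ->
  exists2 j, (j < J)%N & Z `<=` F j.
Proof.
move=> irr cF cov; apply: contrapT => h.
have avoid j : (j < J)%N -> exists2 v, Z v & ~ F j v.
  move=> jJ; apply: contrapT => h'; apply: h; exists j => // v Zv.
  by apply: contrapT => nF; apply: h'; exists v.
suff [p pF [v Zv]] : exists2 p, forall j v, (j < J)%N -> F j v -> p.@[v ord0] = 0 &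
    exists2 v, Z v & p.@[v ord0] != 0.
  by rewrite (cov p pF v Zv) eqxx.
elim: J avoid {cov h} => [|J IH] avoid.
  have [[v Zv] _] := irr; exists 1 => //; exists v => //.
  by rewrite meval1 oner_eq0.
have [j jJ|p pF [v Zv pv]] := IH; first by apply: avoid; apply: leqW.
have [w Zw nF] := avoid J (ltnSn J); have [q qF qw] := closed_avoid (cF J) nF.
exists (p * q) => [j x|].
  rewrite ltnS leq_eqVlt mevalM => /orP[/eqP -> /qF ->|jJ /(pF _ _ jJ) ->].
    by rewrite mulr0.
  by rewrite mul0r.
apply: contrapT => h; case: (irreducible_prime (p := p) (q := q) irr) => [x Zx||].
- by apply/eqP/negPn/negP => pq; apply: h; exists x.
- by move/(_ v Zv)/eqP; rewrite (negPf pv).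
- by move/(_ w Zw)/eqP; rewrite (negPf qw).
Qed.

(** The top of the chain lies in the closure of a single image. Polynomials a_i separating
    consecutive members, pulled back to the parameters, satisfy a relation if e > m; the relation
    passes to the closure of the image, against [chain_independent]. *)
Lemma chain_length_le m (J : nat) (Phi : nat -> 'rV[K]_m -> 'rV[K]_N) A :
  (forall j i, polyfun (fun v => Phi j v ord0 i)) ->
  (forall x, A x -> exists j v, (j < J)%N /\ x = Phi j v) ->
  forall e C, irreducible_chain (zariski_closure A) e C -> (e <= m)%N.
Proof.
move=> PhiP cov e C [irr str]; rewrite leqNgt; apply/negP => me.
have [_ irrC CA] := irr e (leqnn e).
have [||j jJ Cj] := irreducible_finite_union (J := J)
    (F := fun j => zariski_closure (range (Phi j))) irrC.
- by move=> j; exact: zariski_closed_closure.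
- move=> p pF v /CA; apply: vanish_closure => x /cov [j [w [jJ ->]]].
  by apply: pF jJ _; apply: sub_zariski_closure; exists w.
have /boolp.choice [a aP] : forall i, exists a : {mpoly K[N]}, (i < e)%N ->
    (forall v, C i v -> a.@[v ord0] = 0) /\ exists2 v, C i.+1 v & a.@[v ord0] != 0.
  move=> i.
  have [ie|ie] := ltnP i e; last by exists 0.
  have [v Cv nCv] : exists2 v, C i.+1 v & ~ C i v.
    apply: contrapT => h; have [_] := str i ie; apply=> v Cv.
    by apply: contrapT => nCv; apply: h; exists v.
  have [cC _ _] := irr i (ltnW ie).
  by have [p pC pv] := closed_avoid cC nCv; exists p => _; split=> //; exists v.
have /boolp.choice [q qP] : forall i : 'I_e, exists q : {mpoly K[m]}, forall v,
    (a i).@[Phi j v ord0] = q.@[v ord0].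
  move=> i.
  by apply: (@polyfun_comp K m N (fun w => (a i).@[w ord0])) => //; exists (a i).
have [p p0 pq] := algebraically_dependent q me.
case/eqP: p0; apply: (chain_independent (C := C) (a := a)) => [i ie|i ie|v Cv].
- by have [] := irr i ie.
- by have [a0 a1] := aP i ie; split=> //; have [] := str i ie.
have := @vanish_closure (range (Phi j)) (p \mPo [tuple a i | i < e]) _ v (Cj v Cv).
rewrite comp_mpoly_meval => h; rewrite -[RHS]h => [|w [x _ <-]].
  by apply: meval_eq => i; rewrite tnth_mktuple.
rewrite comp_mpoly_meval -[RHS](meval0 (x ord0)) -pq comp_mpoly_meval.
by apply: meval_eq => i; rewrite !tnth_mktuple qP.
Qed.

End Dimension.

(** * Closures of images of affine spaces *)

Section PolynomialImages.
Local Open Scope classical_set_scope.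
Variables (K : closedFieldType) (m : nat).

Lemma polyfun_line (u : 'rV[K]_m -> K) (s t : 'rV[K]_m) : polyfun u ->
  exists h : {poly K}, forall c, u (s + c *: (t - s)) = h.[c].
Proof.
move=> [p pE].
exists (mmap polyC (fun i => (s ord0 i)%:P + (t ord0 i - s ord0 i)%:P * 'X) p) => c.
rewrite pE mevalE /mmap horner_sum; apply: eq_bigr => l _.
rewrite hornerM hornerC /mmap1 horner_prod; congr (_ * _); apply: eq_bigr => i _.
by rewrite horner_exp hornerD hornerM hornerX !hornerC !mxE mulrC.
Qed.

Definition line_closed (L : set 'rV[K]_m) : Prop :=
  forall s t c, L s -> L t -> L (s + c *: (t - s)).

(** On the line through s and t both functions are nonzero polynomials in one variable, and over an
    infinite field these have a common nonroot. Closure of L under lines is all that is used. *)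
Lemma polyfun_common_nonzero (L : set 'rV[K]_m) (u w : 'rV[K]_m -> K) s t :
  line_closed L -> polyfun u -> polyfun w -> L s -> L t -> u s != 0 -> w t != 0 ->
  exists2 r, L r & u r != 0 /\ w r != 0.
Proof.
move=> lL uP wP Ls Lt us wt.
have [h hE] := polyfun_line s t uP; have [g gE] := polyfun_line s t wP.
have h0 : h != 0.
  by apply: contraNneq us => h0; have := hE 0; rewrite h0 horner0 scale0r addr0 => ->.
have g0 : g != 0.
  apply: contraNneq wt => g0; have := gE 1; rewrite g0 horner0 scale1r.
  by rewrite addrC subrK => ->.
have /closed_nonrootP [c] : h * g != 0 by rewrite mulf_neq0.
rewrite rootM negb_or !rootE -hE -gE => /andP[uc wc].
by exists (s + c *: (t - s)); first exact: lL.
Qed.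

Variables (N : nat) (Phi : 'rV[K]_m -> 'rV[K]_N).
Hypothesis PhiP : forall i, polyfun (fun v => Phi v ord0 i).

Lemma polyfun_pullback (p : {mpoly K[N]}) : polyfun (fun v => p.@[Phi v ord0]).
Proof. by apply: (@polyfun_comp K m N (fun w => p.@[w ord0])) => //; exists p. Qed.

Lemma irreducible_image (L : set 'rV[K]_m) : line_closed L -> L !=set0 ->
  zariski_irreducible (zariski_closure (Phi @` L)).
Proof.
move=> lL [s0 Ls0]; split.
  by exists (Phi s0); apply: sub_zariski_closure; exists s0.
move=> Z1 Z2 cZ1 cZ2 ZZ; apply: contrapT => /not_orP[n1 n2].
have avoid Z : zariski_closed Z -> ~ (zariski_closure (Phi @` L) `<=` Z) ->
    exists p, (forall w, Z w -> p.@[w ord0] = 0) /\ exists2 s, L s & p.@[Phi s ord0] != 0.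
  move=> cZ nZ; apply: contrapT => h; apply: nZ; apply: zariski_closure_sub => //.
  move=> _ [s Ls <-]; apply: contrapT => nZ; apply: h.
  by have [p pZ ps] := closed_avoid cZ nZ; exists p; split=> //; exists s.
have [p [pZ [s Ls ps]]] := avoid Z1 cZ1 n1; have [q [qZ [t Lt qt]]] := avoid Z2 cZ2 n2.
have [r Lr [pr qr]] := polyfun_common_nonzero lL (polyfun_pullback p)
  (polyfun_pullback q) Ls Lt ps qt.
have /ZZ [/pZ|/qZ] : zariski_closure (Phi @` L) (Phi r).
- by apply: sub_zariski_closure; exists r.
- by move/eqP; rewrite (negPf pr).
- by move/eqP; rewrite (negPf qr).
Qed.

(** The locus where [delta] is nonzero is dense in the parameters. Degenerate parameters, whose
    images are not in A, thus become available for building chains. *)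
Lemma image_sub_closure (A : set 'rV[K]_N) (delta : 'rV[K]_m -> K) t :
  polyfun delta -> delta t != 0 -> (forall v, delta v != 0 -> A (Phi v)) ->
  forall v, zariski_closure A (Phi v).
Proof.
move=> dP dt dA v Z [cZ AZ]; apply: contrapT => nZ.
have [p pZ pv] := closed_avoid cZ nZ.
have [r _ [pr dr]] := polyfun_common_nonzero (L := setT) (fun _ _ _ _ _ => I)
  (polyfun_pullback p) dP I I pv dt.
by move/eqP: pr; apply; apply: pZ; apply: AZ; apply: dA.
Qed.

(** The i-th member is the closure of the image of the subspace where the parameters from the i-th
    on are 0; the coordinate [test i] vanishes on it but not on the next member. *)
Lemma chain_exists (A : set 'rV[K]_N) (test : nat -> 'I_N) :
  (forall v, zariski_closure A (Phi v)) ->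
  (forall i (v : 'rV[K]_m), (i < m)%N -> (forall j : 'I_m, (i <= j)%N -> v ord0 j = 0) ->
     Phi v ord0 (test i) = 0) ->
  (forall i, (i < m)%N -> exists2 v : 'rV[K]_m,
     forall j : 'I_m, (i < j)%N -> v ord0 j = 0 & Phi v ord0 (test i) != 0) ->
  exists C, irreducible_chain (zariski_closure A) m C.
Proof.
move=> PhiA test0 test1.
pose L i : set 'rV[K]_m := [set v | forall j : 'I_m, (i <= j)%N -> v ord0 j = 0].
have lL i : line_closed (L i).
  by move=> s t c Ls Lt j ij; rewrite !mxE Ls // Lt // subr0 mulr0 addr0.
have L0 i : L i !=set0 by exists 0 => j _; rewrite mxE.
exists (fun i => zariski_closure (Phi @` L i)); split=> [i _|i im].
  split; [exact: zariski_closed_closure | exact: irreducible_image |].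
  apply: zariski_closure_sub; first exact: zariski_closed_closure.
  by move=> _ [v _ <-]; exact: PhiA.
split.
  apply: zariski_closure_sub; first exact: zariski_closed_closure.
  move=> _ [v Lv <-]; apply: sub_zariski_closure; exists v => // j ij.
  by apply: Lv; apply: ltnW.
move=> sub; have [v Lv nz] := test1 i im.
have : zariski_closure (Phi @` L i) (Phi v).
  by apply: sub; apply: sub_zariski_closure; exists v.
move/(vanish_closure (p := 'X_(test i))) => h.
move/eqP: nz; apply; rewrite -[LHS](mevalXU (Phi v ord0)); apply: h => _ [w Lw <-].
by rewrite mevalXU; exact: test0.
Qed.

End PolynomialImages.

(** * Automorphisms of bounded degree *)

Section Endomorphisms.
Variable K : closedFieldType.
Local Notation R2 := {mpoly K[2]}.
Implicit Types (f g : R2).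

Lemma endo_sub2 (phi : endo K) p : phi p = sub2 (phi 'X_0) (phi 'X_1) p.
Proof.
have phi1 : phi 1 = 1 by exact: (rmorph1 (phi : {lrmorphism R2 -> R2})).
have phiZ := linearZ_LR (phi : {lrmorphism R2 -> R2}).
have phiC c : phi c%:MP = c%:MP.
  have e : phi c%:A = c *: phi 1 by exact: phiZ.
  by rewrite -alg_mpolyC e phi1.
by rewrite sub2_bieval; exact: (bieval_unique (t := phi)).
Qed.

Lemma endo_autpair (phi : endo K) : bijective phi -> autpair (phi 'X_0) (phi 'X_1).
Proof.
case=> psi psiK phiK; exists (psi 'X_0), (psi 'X_1).
rewrite -!endo_sub2 !phiK; split=> //; apply: (can_inj psiK).
  by rewrite endo_sub2 sub2_comp -!endo_sub2 !phiK sub2_id.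
by rewrite [LHS]endo_sub2 sub2_comp -!endo_sub2 !phiK sub2_id.
Qed.

Lemma autpair_endo f g : autpair f g ->
  exists phi : endo K, [/\ bijective phi, phi 'X_0 = f & phi 'X_1 = g].
Proof.
move=> [F [G [FE GE fE gE]]].
pose phi : endo K := comp_mpoly [tuple f; g].
have phi0 : phi 'X_0 = f by rewrite /phi /= comp_mpolyXU.
have phi1 : phi 'X_1 = g by rewrite /phi /= comp_mpolyXU.
exists phi; split=> //; exists (sub2 F G) => p.
  by rewrite endo_sub2 phi0 phi1 sub2_comp fE gE sub2_id.
by rewrite endo_sub2 phi0 phi1 sub2_comp FE GE sub2_id.
Qed.

Variable n : nat.

Definition pair_point f g : 'rV[K]_(n.+1 * n.+2) :=
  \row_k (if (coef_of_ord k).1 == 0 then f else g)@_((coef_of_ord k).2).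

Lemma endo_pointE (phi : endo K) : endo_point n phi = pair_point (phi 'X_0) (phi 'X_1).
Proof.
apply/rowP => k; rewrite !mxE; case: (coef_of_ord k) => i m /=.
by case: (ord2_cases i) => ->.
Qed.

Lemma aut_leP x : aut_le K n x <-> exists f g,
  [/\ autpair f g, (total_deg f <= n)%N, (total_deg g <= n)%N & x = pair_point f g].
Proof.
split=> [[phi [bphi dphi] <-]|[f [g [afg fn gn ->]]]].
  exists (phi 'X_0), (phi 'X_1); rewrite endo_pointE.
  by move: dphi; rewrite /endo_deg geq_max => /andP[? ?]; split=> //; exact: endo_autpair.
have [phi [bphi p0 p1]] := autpair_endo afg; exists phi; last by rewrite endo_pointE p0 p1.
by split=> //; rewrite /endo_deg p0 p1 geq_max fn gn.
Qed.

Lemma polyfun_pair_point m (F G : 'rV[K]_m -> R2) k : polyfam F -> polyfam G ->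
  polyfun (fun v => pair_point (F v) (G v) ord0 k).
Proof.
move=> [_ FP] [_ GP]; rewrite /pair_point.
case e : ((coef_of_ord k).1 == 0).
  by apply: polyfun_ext (FP (coef_of_ord k).2) => v; rewrite mxE e.
by apply: polyfun_ext (GP (coef_of_ord k).2) => v; rewrite mxE e.
Qed.

(** The inverse of [coef_of_ord]. A monomial of degree above n falls back on the constant monomial,
    so the value is meaningful up to degree n only. *)
Definition coef_pos (i : 'I_2) (m : 'X_{1..2}) : 'I_(n.+1 * n.+2) :=
  cast_ord (card_coef_index n) (enum_rank (i, insubd (BMultinom (bm0_proof 2 n)) m)).

Lemma pair_point_pos f g i m : (mdeg m <= n)%N ->
  pair_point f g ord0 (coef_pos i m) = (if i == 0 then f else g)@_m.
Proof.
move=> mn; rewrite mxE /coef_pos /coef_of_ord cast_ordK enum_rankK /=.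
by rewrite insubdK // unfold_in ltnS.
Qed.

Lemma aut_le_chain_le e C :
  irreducible_chain (zariski_closure (aut_le K n)) e C -> (e <= n + 6)%N.
Proof.
have [J [F [G [FG cov]]]] := covered_autpair K n.
apply: (chain_length_le (J := J) (Phi := fun j v => pair_point (F j v) (G j v))).
  by move=> j i; have [? ?] := FG j; exact: polyfun_pair_point.
move=> x /aut_leP [f [g [afg fn gn ->]]].
have [|j [v [jJ -> ->]]] := cov f g; first by split.
by exists j, v.
Qed.

(** * A family of dimension n + 6 *)

Definition shear_line (la : K) : R2 := 'X_0 + la *: 'X_1.

Definition shear_sum (p : nat -> K) (l : R2) : R2 := \sum_(i < n.-1) p i *: l ^+ i.+2.

Definition shear_family (a b c la : K) (p : nat -> K) : R2 :=
  a *: shear_line la + b *: ('X_1 + shear_sum p (shear_line la)) + c%:MP.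

(** Along the line (al T, be T) the linear form [shear_line] is a multiple of T. The two axes give
    the coefficients at pure powers of x and y, the only ones tested. *)
Lemma shear_family_axis al be a b c la p :
  bieval (@polyC K) (al *: 'X) (be *: 'X) (shear_family a b c la p) =
  (a * (al + la * be) + b * be) *: 'X +
  b *: (\sum_(i < n.-1) (p i * (al + la * be) ^+ i.+2) *: 'X^(i.+2)) + c%:P.
Proof.
have lE : bieval (@polyC K) (al *: 'X) (be *: 'X) (shear_line la) = (al + la * be) *: 'X.
  rewrite /shear_line rmorphD /= bievalZ bieval_X0 bieval_X1 mul_polyC.
  by rewrite scalerA -scalerDl.
rewrite /shear_family !rmorphD /= bievalC !bievalZ lE !mul_polyC rmorphD /= bieval_X1.
rewrite /shear_sum rmorph_sum /= scalerDr addrA !scalerA -scalerDl.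
congr (_ + _ *: _ + _); apply: eq_bigr => i _.
by rewrite bievalZ rmorphXn /= lE exprZn mul_polyC scalerA.
Qed.

Lemma coef_shear_sum (p : nat -> K) (mu : K) j :
  (\sum_(i < n.-1) (p i * mu ^+ i.+2) *: 'X^(i.+2))`_j =
  if (1 < j <= n)%N then p j.-2 * mu ^+ j else 0.
Proof.
rewrite coef_sum; under eq_bigr do rewrite coefZ coefXn.
case: ifP => [/andP[j1 jn]|h].
  have jn' : (j.-2 < n.-1)%N by lia.
  rewrite (bigD1 (Ordinal jn')) //= big1 => [|i]; last first.
    rewrite -val_eqE /= => ij; case: eqP => e; last by rewrite mulr0.
    by rewrite e eqxx in ij.
  by case: j j1 jn jn' => [|[|j]] //= _ _ _; rewrite eqxx mulr1 addr0.
rewrite big1 // => i _; case: eqP => [e|]; last by rewrite mulr0.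
by move: h; rewrite e ltnS /=; have := ltn_ord i; lia.
Qed.

Lemma coef_shear_family_x a b c la p j :
  (shear_family a b c la p)@_(mnm2 j 0) =
  (if j == 1 then a else 0) + b * (if (1 < j <= n)%N then p j.-2 else 0) +
  (if j == 0 then c else 0).
Proof.
have := shear_family_axis 1 0 a b c la p; rewrite scale1r scale0r !mulr0 !addr0 mulr1.
rewrite -coef_xrest => ->; rewrite !coefD !coefZ coefX coefC coef_shear_sum expr1n mulr1.
by case: eqP => _; rewrite ?mulr1 ?mulr0.
Qed.

Lemma coef_shear_family_y a b c la p j :
  (shear_family a b c la p)@_(mnm2 0 j) =
  (if j == 1 then a * la + b else 0) +
  b * (if (1 < j <= n)%N then p j.-2 * la ^+ j else 0) + (if j == 0 then c else 0).
Proof.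
have := shear_family_axis 0 1 a b c la p; rewrite scale1r scale0r !mulr1 add0r.
rewrite -coef_yrest /yrest => ->; rewrite !coefD !coefZ coefX coefC coef_shear_sum.
by case: eqP => _; rewrite ?mulr1 ?mulr0.
Qed.

Lemma polyfam_shear_family m (a b c la : 'rV[K]_m -> K) (p : nat -> 'rV[K]_m -> K) :
  polyfun a -> polyfun b -> polyfun c -> polyfun la -> (forall i, polyfun (p i)) ->
  polyfam (fun v => shear_family (a v) (b v) (c v) (la v) (p^~ v)).
Proof.
move=> aP bP cP lP pP.
have lineP : polyfam (fun v => shear_line (la v)).
  by apply: polyfamD (polyfam_const _) (polyfamZ lP (polyfam_const _)).
apply: polyfamD; last first.
  by apply: polyfam_ext (polyfamZ cP (polyfam_const 1)) => v; rewrite -mul_mpolyC mulr1.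
apply: polyfamD; apply: polyfamZ => //; apply: polyfamD; first exact: polyfam_const.
by apply: polyfam_sum => i; apply: polyfamZ => //; apply: polyfamX.
Qed.

Lemma total_deg_shear_family a b c la p : (1 < n)%N ->
  (total_deg (shear_family a b c la p) <= n)%N.
Proof.
move=> n1; apply/total_degP.
have w1 : wle 1 1 1 (shear_line la).
  by apply: wleD; [exact: wle_X0 | apply: wleZ; exact: wle_X1].
apply: wleD; last exact: wleC.
apply: wleD; apply: wleZ; first exact: wleW (ltnW n1) w1.
apply: wleD; first exact: wleW (ltnW n1) (wle_X1 _ _).
apply: wle_sum => i; apply: wleZ; apply: wleW (@wleX _ _ _ _ _ i.+2 w1).
by have := ltn_ord i; lia.
Qed.

Lemma affine_inverse (S : comNzRingType) (e a b a' b' x y : S) :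
  e * (a * b' - a' * b) = 1 ->
  [/\ e * b' * (a * x + b * y) - e * b * (a' * x + b' * y) = x,
      e * a * (a' * x + b' * y) - e * a' * (a * x + b * y) = y,
      a * (e * b' * x - e * b * y) + b * (e * a * y - e * a' * x) = x &
      a' * (e * b' * x - e * b * y) + b' * (e * a * y - e * a' * x) = y].
Proof.
by move=> h; split; [rewrite -[RHS]mul1r -h|rewrite -[RHS]mul1r -h|
  rewrite -[RHS]mul1r -h|rewrite -[RHS]mul1r -h]; ring.
Qed.

Lemma autpair_affine (a b c a' b' c' : K) : a * b' - a' * b != 0 ->
  autpair (a%:MP * 'X_0 + b%:MP * 'X_1 + c%:MP) (a'%:MP * 'X_0 + b'%:MP * 'X_1 + c'%:MP).
Proof.
move=> d0; set d := (_ - _) in d0.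
have h : (d^-1)%:MP * (a%:MP * b'%:MP - a'%:MP * b%:MP) = 1 :> R2.
  by rewrite -!rmorphM -rmorphB -rmorphM /= mulVf.
have [h1 h2 _ _] := affine_inverse 'X_0 'X_1 h.
have [_ _ h3 h4] := affine_inverse ('X_0 - c%:MP) ('X_1 - c'%:MP) h.
exists ((d^-1)%:MP * b'%:MP * ('X_0 - c%:MP) - (d^-1)%:MP * b%:MP * ('X_1 - c'%:MP)),
  ((d^-1)%:MP * a%:MP * ('X_1 - c'%:MP) - (d^-1)%:MP * a'%:MP * ('X_0 - c%:MP)).
split.
- by rewrite !(rmorphB, rmorphM) /= !sub2C sub2_X0 sub2_X1 !addrK.
- by rewrite !(rmorphB, rmorphM) /= !sub2C sub2_X0 sub2_X1 !addrK.
- by rewrite !(rmorphD, rmorphM) /= !sub2C sub2_X0 sub2_X1 h3 subrK.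
- by rewrite !(rmorphD, rmorphM) /= !sub2C sub2_X0 sub2_X1 h4 subrK.
Qed.

Lemma autpair_shear_family (a b c a' b' c' la : K) p : a * b' - a' * b != 0 ->
  autpair (shear_family a b c la p) (shear_family a' b' c' la p).
Proof.
move=> d0; pose P : {poly K} := \sum_(i < n.-1) p i *: 'X^(i.+2).
have PE l : peval P l = shear_sum p l.
  rewrite /P /shear_sum; elim: (n.-1) => [|k IH]; last first.
    by rewrite !big_ord_recr pevalD IH pevalZXn.
  by rewrite !big_ord0 -polyC0 pevalC mpolyC0.
have a1 : autpair (shear_line la) 'X_1.
  exists ('X_0 - la *: 'X_1), 'X_1; rewrite /shear_line; split; rewrite ?sub2_X1 //.
    by rewrite rmorphB /= sub2Z sub2_X0 sub2_X1 addrK.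
  by rewrite rmorphD /= sub2Z sub2_X0 sub2_X1 subrK.
have := autpair_sub2 (autpair_peval P) a1.
rewrite rmorphD /= sub2_peval sub2_X0 sub2_X1 PE => a2.
have := autpair_sub2 (autpair_affine c c' d0) a2.
by rewrite !rmorphD !rmorphM /= !sub2C sub2_X0 sub2_X1 !mul_mpolyC.
Qed.

(** The parameters come in the order c, c', a, a', b, the coefficients of P, b', la. The slope la is
    last: b and b' are read off a la + b and a' la + b' while la = 0, and la itself is seen in the
    coefficient of y^2 in the first image, b times the first coefficient of P times la^2. *)
Definition shear_fst m (v : 'rV[K]_m) : R2 :=
  shear_family (crd v 2) (crd v 4) (crd v 0) (crd v (n + 5)) (fun i => crd v (5 + i)).

Definition shear_snd m (v : 'rV[K]_m) : R2 :=
  shear_family (crd v 3) (crd v (n + 4)) (crd v 1) (crd v (n + 5)) (fun i => crd v (5 + i)).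

(* A coordinate which vanishes identically as long as the parameters from the
   i-th on are zero, but not once the i-th parameter is free. *)
Definition shear_test (i : nat) : 'I_(n.+1 * n.+2) :=
  match i with
  | 0 => coef_pos 0 (mnm2 0 0)
  | 1 => coef_pos 1 (mnm2 0 0)
  | 2 => coef_pos 0 (mnm2 1 0)
  | 3 => coef_pos 1 (mnm2 1 0)
  | 4 => coef_pos 0 (mnm2 0 1)
  | k.+4.+1 => if (k < n.-1)%N then coef_pos 0 (mnm2 k.+2 0)
            else if k == n.-1 then coef_pos 1 (mnm2 0 1) else coef_pos 0 (mnm2 0 2)
  end.

Lemma shear_testE m (v : 'rV[K]_m) i : (1 < n)%N ->
  pair_point (shear_fst v) (shear_snd v) ord0 (shear_test i) =
  match i with
  | 0 => crd v 0
  | 1 => crd v 1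
  | 2 => crd v 2
  | 3 => crd v 3
  | 4 => crd v 2 * crd v (n + 5) + crd v 4
  | k.+4.+1 => if (k < n.-1)%N then crd v 4 * crd v (5 + k)
            else if k == n.-1 then crd v 3 * crd v (n + 5) + crd v (n + 4)
            else crd v 4 * (crd v 5 * crd v (n + 5) ^+ 2)
  end.
Proof.
move=> n1; have mn j k : (j + k <= n)%N -> (mdeg (mnm2 j k) <= n)%N.
  by rewrite mdeg2 mnm2_0 mnm2_1.
case: i => [|[|[|[|[|k]]]]] /=; last first.
  case: ifP => kn; last case: ifP => kn'; rewrite pair_point_pos ?mn ?(ltnW n1) //=; try lia.
  - rewrite coef_shear_family_x /= addr0 add0r; congr (_ * _).
    by case: ifP => //; lia.
  - by rewrite coef_shear_family_y /= mulr0 !addr0.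
  - by rewrite coef_shear_family_y /= n1 add0r addr0.
- by rewrite pair_point_pos ?mn ?(ltnW n1) //= coef_shear_family_y /= mulr0 !addr0.
- by rewrite pair_point_pos ?mn ?(ltnW n1) //= coef_shear_family_x /= mulr0 !addr0.
- by rewrite pair_point_pos ?mn ?(ltnW n1) //= coef_shear_family_x /= mulr0 !addr0.
- by rewrite pair_point_pos ?mn ?(ltnW n1) //= coef_shear_family_x /= mulr0 !add0r.
- by rewrite pair_point_pos ?mn ?(ltnW n1) //= coef_shear_family_x /= mulr0 !add0r.
Qed.

Lemma aut_le_chain_exists : (1 < n)%N ->
  exists C, irreducible_chain (zariski_closure (aut_le K n)) (n + 6) C.
Proof.
move=> n1.
pose Phi (v : 'rV[K]_(n + 6)) := pair_point (shear_fst v) (shear_snd v).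
(* The determinant a b' - a' b of the affine part; where it is nonzero, the pair is an
   automorphism. *)
pose delta (v : 'rV[K]_(n + 6)) := crd v 2 * crd v (n + 4) - crd v 3 * crd v 4.
(* Parameters 0 to i equal 1 and the later ones 0, so every product in a test coefficient takes the
   value 0 or 1. *)
pose ones i : 'rV[K]_(n + 6) := \row_j (j <= i)%N%:R.
have onesE i k : (k < n + 6)%N -> crd (ones i) k = (k <= i)%N%:R.
  exact: (crd_row (fun k => (k <= i)%N%:R)).
have PhiP i : polyfun (fun v => Phi v ord0 i).
  by apply: polyfun_pair_point; apply: polyfam_shear_family => *; exact: polyfun_crd.
have dP : polyfun delta.
  have h i j : polyfun (fun v : 'rV[K]_(n + 6) => crd v i * crd v j).
    by apply: polyfunM; exact: polyfun_crd.
  apply: polyfun_ext (polyfunD (h 2 (n + 4)%N) (polyfunM (polyfun_const (-1)) (h 3 4))) => v.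
  by rewrite mulN1r.
(* a = b' = 1 and all other parameters 0, so that the determinant is 1. *)
pose t : 'rV[K]_(n + 6) := \row_j ((j == 2 :> nat) || (j == n + 4 :> nat))%N%:R.
have tE k : (k < n + 6)%N -> crd t k = ((k == 2) || (k == n + 4))%N%:R.
  exact: (crd_row (fun k => ((k == 2) || (k == n + 4))%N%:R)).
have dt : delta t != 0.
  have t2 : crd t 2 = 1 by rewrite tE //; lia.
  have tn : crd t (n + 4) = 1 by rewrite tE ?eqxx ?orbT //; lia.
  have t3 : crd t 3 = 0.
    rewrite tE; last by lia.
    by have -> : (3 == n + 4)%N = false by lia.
  by rewrite /delta t2 tn t3 mulr1 mul0r subr0 oner_eq0.
apply: (chain_exists PhiP (test := shear_test)) => [|i v im vz|i im].
- apply: (image_sub_closure PhiP dP dt) => v dv; apply/aut_leP.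
  exists (shear_fst v), (shear_snd v); split=> //; try exact: total_deg_shear_family.
  exact: autpair_shear_family.
- have z k : (i <= k)%N -> crd v k = 0.
    by move=> ik; rewrite /crd; case: insubP => // j _ jk; rewrite vz // jk.
  rewrite /Phi shear_testE //; case: i im vz z => [|[|[|[|[|k]]]]] im _ z; last first.
    case: ltnP => kn; first by rewrite (z (5 + k)%N) ?mulr0.
    case: eqP => kn'.
      by rewrite (z (n + 5)%N) ?(z (n + 4)%N) ?mulr0 ?addr0 //; lia.
    by rewrite (z (n + 5)%N) ?expr0n /= ?mulr0 //; lia.
  all: try by rewrite z.
  by rewrite (z (n + 5)%N) ?(z 4) ?mulr0 ?addr0 //; lia.
exists (ones i) => [j ij|]; first by rewrite mxE leqNgt ij.
rewrite /Phi shear_testE //; case: i im => [|[|[|[|[|k]]]]] im; last first.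
  have one j : (j <= k.+4.+1)%N -> crd (ones k.+4.+1) j = 1.
    by move=> jk; rewrite onesE ?jk //; lia.
  case: ltnP => kn; first by rewrite !one ?mulr1 ?oner_eq0 //; lia.
  case: (k =P n.-1)%N => kn'; last by rewrite !one ?expr1n ?mulr1 ?oner_eq0 //; lia.
  have -> : crd (ones k.+4.+1) (n + 5) = 0.
    rewrite onesE; last by lia.
    by have -> : (n + 5 <= k.+4.+1)%N = false by lia.
  by rewrite (one (n + 4)%N) ?mulr0 ?add0r ?oner_eq0 //; lia.
all: try by rewrite onesE ?oner_eq0 //; lia.
have -> : crd (ones 4) (n + 5) = 0.
  rewrite onesE; last by lia.
  by have -> : (n + 5 <= 4)%N = false by lia.
by rewrite mulr0 add0r onesE ?oner_eq0 //; lia.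
Qed.

End Endomorphisms.

Theorem corollary1p4 (K : closedFieldType) (n : nat) (hn : (2 <= n)%N) :
  zariski_dim_is (aut_le K n) (n + 6)%N.
Proof.
split; first exact: aut_le_chain_exists.
by move=> e C; exact: aut_le_chain_le.
Qed.
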